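(* For any $k=\delta n=n/\mathrm{poly}(\log n)$ and any constant $\gamma\in(0,1)$, there exists an explicit construction of a strong $(k,\epsilon)$-extractor $\mathsf{Ext}:\{0,1\}^n\times\{0,1\}^d\to\{0,1\}^m$, where $\epsilon$ can be as small as $2^{-k^{\Omega(1)}}$, with $d=k^{\alpha}$ for some constant $\alpha\in(0,1]$, $m=(1-\gamma)k$, and locality $\log^2(1/\epsilon)\cdot\mathrm{poly}(\log n)$.
   Context: An $(n,k)$-source is a distribution on $\{0,1\}^n$ with min-entropy at least $k$. $\mathsf{Ext}$ is a strong $(k,\epsilon)$-extractor if for every $(n,k)$-source $X$ and independent uniform seed $U\in\{0,1\}^d$, $U\circ\mathsf{Ext}(X,U)$ is $\epsilon$-close in statistical distance to uniform on $\{0,1\}^{d+m}$. The locality is $\ell$ if for every fixed seed $r$, each output bit of $x\mapsto\mathsf{Ext}(x,r)$ depends on at most $\ell$ bits of $x$. ''$\epsilon$ can be as small as $2^{-k^{\Omega(1)}}$'' means: there is a constant $\beta\in(0,1)$ such that the statement holds for every $\epsilon\ge 2^{-k^{\beta}}$. Explicit means polynomial-time computable. Asymptotics are as $n\to\infty$.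
   Formalization: The error ε is assumed to be at most some constant ε0 < 1, with ''n large'' allowed to depend on ε0; for ε tending to 1 too fast the locality bound log^2(1/ε)·poly(log n) would drop below 1 and the claim would be false. *)

(* Defs.v *)
From HB Require Import structures.
From mathcomp Require Import all_boot all_order all_algebra.
From mathcomp Require Import all_classical all_reals all_analysis.

Set Implicit Arguments.
Unset Strict Implicit.
Unset Printing Implicit Defensive.

Import Order.TTheory GRing.Theory Num.Theory.
Local Open Scope ring_scope.

Definition log2 (R : realType) (x : R) : R := ln x / ln 2.

(* {0,1}^n is rendered as n.-tuple bool. *)

Record dist (R : realType) (T : finType) := Dist {
  pmf :> T -> R;
  pmf_ge0 : forall x, 0 <= pmf x;
  pmf_sum1 : \sum_x pmf x = 1 }.

Section Distributions.
Variable R : realType.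

Lemma unif_ge0 n (x : n.-tuple bool) : 0 <= (2 ^+ n)^-1 :> R.
Proof. by rewrite invr_ge0 exprn_ge0. Qed.

Lemma unif_sum1 n : \sum_(x : n.-tuple bool) (2 ^+ n)^-1 = 1 :> R.
Proof.
by rewrite sumr_const card_tuple card_bool -[_ *+ _]mulr_natr natrX mulVf.
Qed.

Definition unif n : dist R (n.-tuple bool) := Dist (@unif_ge0 n) (unif_sum1 n).

Section Product.
Variables (T U : finType) (P : dist R T) (Q : dist R U).

Lemma dprod_ge0 (z : T * U) : 0 <= P z.1 * Q z.2.
Proof. by rewrite mulr_ge0 // pmf_ge0. Qed.

Lemma dprod_sum1 : \sum_(z : T * U) P z.1 * Q z.2 = 1.
Proof.
rewrite -(pair_bigA _ (fun x y => P x * Q y)) /=.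
rewrite -[RHS](pmf_sum1 P); apply: eq_bigr => x _.
by rewrite -mulr_sumr pmf_sum1 mulr1.
Qed.

(* The joint law of two independent random variables. *)
Definition dprod : dist R (T * U)%type := Dist dprod_ge0 dprod_sum1.
End Product.

Section Pushforward.
Variables (T U : finType) (f : T -> U) (P : dist R T).

Lemma dmap_ge0 y : 0 <= \sum_(x | f x == y) P x.
Proof. by apply: sumr_ge0 => x _; exact: pmf_ge0. Qed.

Lemma dmap_sum1 : \sum_y \sum_(x | f x == y) P x = 1.
Proof. by rewrite -(pmf_sum1 P) [RHS](partition_big f xpredT). Qed.

(* The law of f(X) when X has law P. *)
Definition dmap : dist R U := Dist dmap_ge0 dmap_sum1.
End Pushforward.

Definition min_entropy (T : finType) (P : dist R T) : R :=
  - log2 (\big[Num.max/0]_x P x).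

Definition stat_dist (T : finType) (P Q : dist R T) : R :=
  2^-1 * \sum_x `|P x - Q x|.

Definition strong_extractor (n d m : nat) (k eps : R)
    (Ext : n.-tuple bool -> d.-tuple bool -> m.-tuple bool) : Prop :=
  forall X : dist R (n.-tuple bool), k <= min_entropy X ->
    stat_dist
      (dmap (fun xu => cat_tuple xu.2 (Ext xu.1 xu.2)) (dprod X (unif d)))
      (unif (d + m)) <= eps.

(* S collects the bits of x on which output bit j may depend, given r. *)
Definition locality_le (n d m : nat) (l : R)
    (Ext : n.-tuple bool -> d.-tuple bool -> m.-tuple bool) : Prop :=
  forall (r : d.-tuple bool) (j : 'I_m),
    exists S : {set 'I_n}, #|S|%:R <= l /\
      forall x y : n.-tuple bool,
        (forall i, i \in S -> tnth x i = tnth y i) ->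
        tnth (Ext x r) j = tnth (Ext y r) j.

End Distributions.

(* Deterministic multi-tape Turing machines over the tape alphabet {0,1,blank},
   a cell being an option bool with None for the blank.                       *)

Inductive move := MoveL | MoveS | MoveR.

(* (l, r) is the two-way infinite tape  rev l ++ r  padded with blanks on both
   sides, the head being on the first cell of r.                              *)
Definition tape := (seq (option bool) * seq (option bool))%type.

Definition tape_read (t : tape) : option bool := head None t.2.

Definition tape_act (t : tape) (a : option bool * move) : tape :=
  let r := a.1 :: behead t.2 in
  match a.2 with
  | MoveL => (behead t.1, head None t.1 :: r)
  | MoveS => (t.1, r)
  | MoveR => (a.1 :: t.1, behead t.2)
  end.

Definition tape_of_word (w : seq bool) : tape := ([::], map Some w).

Fixpoint word_prefix (s : seq (option bool)) : seq bool :=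
  if s is Some b :: s' then b :: word_prefix s' else [::].

(* The longest blank-free word starting at the head. *)
Definition word_of_tape (t : tape) : seq bool := word_prefix t.2.

(* The machine has tm_last.+1 tapes. *)
Record tm := TM {
  tm_state : finType;
  tm_last : nat;
  tm_start : tm_state;
  tm_halt : pred tm_state;
  tm_trans : tm_state -> {ffun 'I_tm_last.+1 -> option bool} ->
    tm_state * ('I_tm_last.+1 -> option bool * move) }.

Definition tm_config (M : tm) : Type :=
  (tm_state M * ('I_(tm_last M).+1 -> tape))%type.

(* The i-th input word is written on the i-th tape; other tapes are blank. *)
Definition tm_init (M : tm) (ws : seq (seq bool)) : tm_config M :=
  (tm_start M, fun i : 'I_(tm_last M).+1 => tape_of_word (nth [::] ws i)).

(* Halting configurations are fixed points. *)
Definition tm_step (M : tm) (c : tm_config M) : tm_config M :=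
  if tm_halt c.1 then c else
  let a := tm_trans c.1 [ffun i => tape_read (c.2 i)] in
  (a.1, fun i => tape_act (c.2 i) (a.2 i)).

(* On input ws, M halts within t steps with w on its last tape. *)
Definition tm_outputs_within (M : tm) (ws : seq (seq bool)) (w : seq bool)
    (t : nat) : Prop :=
  let c := iter t (@tm_step M) (tm_init M ws) in
  tm_halt c.1 /\ word_of_tape (c.2 ord_max) = w.

Definition input_size (ws : seq (seq bool)) : nat := sumn (map size ws).

(* One Turing machine computes the whole family in polynomial time. Since k, m
   and eps are arbitrary (possibly uncomputable) real or integer parameters, the
   machine is told k, m and ceil(log2(1/eps)), all in unary; n and d are the
   lengths of x and r. In particular the output may depend on eps only through
   ceil(log2(1/eps)).                                                         *)
Definition explicit (R : realType) (k d m : nat -> nat)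
    (Ext : forall n, R ->
       n.-tuple bool -> (d n).-tuple bool -> (m n).-tuple bool) : Prop :=
  exists (M : tm) (c : nat), forall (n : nat) (eps : R)
      (x : n.-tuple bool) (r : (d n).-tuple bool), 0 < eps < 1 ->
    let ws := [:: nseq (k n) true; nseq (m n) true;
                  nseq `|Num.ceil (log2 eps^-1)|%N true;
                  tval x; tval r] in
    tm_outputs_within M ws (Ext n eps x r) (c * input_size ws ^ c + c)%N.

(* Main.v *)
Require Import Defs.
From HB Require Import structures.
From mathcomp Require Import all_boot all_order all_algebra.
From mathcomp Require Import all_classical all_reals all_analysis.
From mathcomp Require Import zify ring lra.

Set Implicit Arguments.
Unset Strict Implicit.
Unset Printing Implicit Defensive.

Import Order.TTheory GRing.Theory Num.Theory.

(* Take alpha = 1, so that the seed has k bits.  Pad x and cut it into l0 groups of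
   2^g cells of B bits; a seed of l0*g bits selects one cell in each group.  Writing
   P(x) as a product of conditional probabilities of the cells, a Chernoff bound
   shows that the selected cells carry their fair share of the entropy, and the
   leftover hash lemma with a random matrix extracts m bits from them.  Because the
   cells are long (B is polylogarithmic), m exceeds several times the l0*g bits spent
   on the selection.  A round applies one matrix to t independent selections, which
   amortizes the cost of the matrix; rounds with independent seeds are concatenated
   until (1-gamma)k bits are produced.  The analysis works with subprobabilities P
   bounded pointwise by 2^-k: conditioning on earlier outputs only restricts P, which
   preserves this bound.  An output bit reads one selection only, that is l0*B bits
   of x, which is log(1/eps) polylog(n).

   For explicitness, the output bits are values of arithmetic expressions with
   bounded sums, compiled to programs on stacks and then to a Turing machine.  The
   expressions grow polynomially, so the running time bound holds for all of them. *)

(** * Turing machines running stack programs *)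

(** Sharing a matrix inside a round forces two kinds of conditioning. Outputs of a round depend on
    its matrix, so fixing them would correlate the source with it; the raw samples, which do not
    involve the matrix, are fixed instead, at [l] bits per block. Between rounds the matrix is fresh
    and only the [t * m] output bits are fixed, so the samples are paid for in one round only.
    Errors have the form slope times mass plus an offset. Masses of the restrictions add up, so
    fixing [l] bits leaves the slope part alone and multiplies only the offset by [2 ^ l]; no
    conditional min-entropy is ever estimated. A block needs about e B L nats in a sample of l = e
    B^2 bits, a 2^-g share of the padded input, hence about n L / B nats in the whole input. With n
    <= k L^a the choice B = L^(a+3) makes this O(k / L^2). A round handles e^2 polylog(n) bits,
    which must be small against gamma k; this is why e is kept of order k^(1/4). *)

Definition stacks := nat -> seq bool.

Definition upd (T : Type) (s : nat -> T) (i : nat) (w : T) : nat -> T :=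
  fun j => if j == i then w else s j.

Inductive sprog :=
| Push of nat & bool
| Pop of nat
| Seq of sprog & sprog
| If of nat & (option bool -> bool) & sprog & sprog
| While of nat & (option bool -> bool) & sprog.

(** The last index counts machine steps exactly: a push moves left and then writes, a pop is one
    move, every test costs one step. *)
Inductive exec : sprog -> stacks -> stacks -> nat -> Prop :=
| exec_push i b s : exec (Push i b) s (upd s i (b :: s i)) 2
| exec_pop i s : exec (Pop i) s (upd s i (behead (s i))) 1
| exec_seq p q s s1 s2 t1 t2 :
    exec p s s1 t1 -> exec q s1 s2 t2 -> exec (Seq p q) s s2 (t1 + t2)
| exec_ifT i (c : option bool -> bool) p q s s1 t :
    c (ohead (s i)) -> exec p s s1 t -> exec (If i c p q) s s1 t.+1
| exec_ifF i (c : option bool -> bool) p q s s1 t :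
    ~~ c (ohead (s i)) -> exec q s s1 t -> exec (If i c p q) s s1 t.+1
| exec_whileF i (c : option bool -> bool) p s : ~~ c (ohead (s i)) -> exec (While i c p)
  s s 1
| exec_whileT i (c : option bool -> bool) p s s1 s2 t1 t2 :
    c (ohead (s i)) -> exec p s s1 t1 -> exec (While i c p) s1 s2 t2 ->
    exec (While i c p) s s2 (t1 + t2).+1.

Fixpoint stacks_below (T : nat) (p : sprog) : bool :=
  match p with
  | Push i _ | Pop i => i <= T
  | Seq p q => stacks_below T p && stacks_below T q
  | If i _ p q => [&& i <= T, stacks_below T p & stacks_below T q]
  | While i _ p => (i <= T) && stacks_below T p
  end.

Section Machine.
Variable T : nat.

Notation reads := {ffun 'I_T.+1 -> option bool}.
Notation acts := ('I_T.+1 -> option bool * move).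
Notation tapes := ('I_T.+1 -> tape).

Definition stay (f : reads) : acts := fun i => (f i, MoveS).
Definition act_on (i : nat) (x : option bool -> option bool * move)
  (f : reads) : acts := fun j => if val j == i then x (f j) else (f j, MoveS).

Fixpoint ctrl (p : sprog) : finType :=
  match p with
  | Push _ _ => bool
  | Pop _ => unit
  | Seq p q => (ctrl p + ctrl q)%type
  | If _ _ p q => option (ctrl p + ctrl q)%type
  | While _ _ p => option (ctrl p)
  end.

Fixpoint entry (p : sprog) : ctrl p :=
  match p with
  | Push _ _ => false
  | Pop _ => tt
  | Seq p q => inl (entry p)
  | If _ _ p q => None
  | While _ _ p => None
  end.

(* The new control state [None] means that the program is finished. *)
Fixpoint trans (p : sprog) : ctrl p -> reads -> option (ctrl p) * acts :=
  match p with
  | Push i b => fun c f =>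
      if c then (None, act_on i (fun _ => (Some b, MoveS)) f)
      else (Some true, act_on i (fun x => (x, MoveL)) f)
  | Pop i => fun _ f => (None, act_on i (fun x => (x, MoveR)) f)
  | Seq p q => fun c f =>
      match c with
      | inl c1 => let r := @trans p c1 f in
          (Some (if r.1 is Some c1' then inl c1' else inr (entry q)), r.2)
      | inr c2 => let r := @trans q c2 f in (omap inr r.1, r.2)
      end
  | If i t p q => fun c f =>
      match c with
      | None => (Some (Some (if t (f (inord i)) then inl (entry p)
                             else inr (entry q))), stay f)
      | Some (inl c1) => let r := @trans p c1 f in
          (omap (fun c => Some (inl c)) r.1, r.2)
      | Some (inr c2) => let r := @trans q c2 f in
          (omap (fun c => Some (inr c)) r.1, r.2)
      end
  | While i t p => fun c f =>
      match c with
      | None => (if t (f (inord i)) then Some (Some (entry p)) else None, stay f)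
      | Some c1 => let r := @trans p c1 f in (Some r.1, r.2)
      end
  end.

Definition read_all (tp : tapes) : reads := [ffun i => tape_read (tp i)].
Definition act_all (tp : tapes) (x : acts) : tapes :=
  fun i => tape_act (tp i) (x i).

Inductive run (p : sprog) : ctrl p -> tapes -> tapes -> nat -> Prop :=
| run_exit c tp x : trans c (read_all tp) = (None, x) ->
    run c tp (act_all tp x) 1
| run_step c c' tp tp' x t : trans c (read_all tp) = (Some c', x) ->
    run c' (act_all tp x) tp' t -> run c tp tp' t.+1.

Lemma run_seq2 p q c tp tp' t : @run q c tp tp' t ->
  @run (Seq p q) (inr c) tp tp' t.
Proof.
elim=> {c tp tp' t} [c tp x E|c c' tp tp' x t E _ IH].
  by apply: run_exit; rewrite /= E.
by apply: run_step IH; rewrite /= E.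
Qed.

Lemma run_seq1 p q c tp tp1 tp2 t1 t2 : @run p c tp tp1 t1 ->
  @run q (entry q) tp1 tp2 t2 -> @run (Seq p q) (inl c) tp tp2 (t1 + t2).
Proof.
elim=> {c tp tp1 t1} [c tp x E|c c' tp tp' x t E _ IH] H.
  by rewrite add1n; apply: run_step (run_seq2 _ H); rewrite /= E.
by rewrite addSn; apply: run_step (IH H); rewrite /= E.
Qed.

Lemma run_if1 i b p q c tp tp' t : @run p c tp tp' t ->
  @run (If i b p q) (Some (inl c)) tp tp' t.
Proof.
elim=> {c tp tp' t} [c tp x E|c c' tp tp' x t E _ IH].
  by apply: run_exit; rewrite /= E.
by apply: run_step IH; rewrite /= E.
Qed.

Lemma run_if2 i b p q c tp tp' t : @run q c tp tp' t ->
  @run (If i b p q) (Some (inr c)) tp tp' t.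
Proof.
elim=> {c tp tp' t} [c tp x E|c c' tp tp' x t E _ IH].
  by apply: run_exit; rewrite /= E.
by apply: run_step IH; rewrite /= E.
Qed.

(** The exit [None] of the body is also the control state of the loop head, so leaving the body
    lands on the test again. *)
Lemma run_while i b p c tp tp1 tp2 t1 t2 : @run p c tp tp1 t1 ->
  @run (While i b p) None tp1 tp2 t2 ->
  @run (While i b p) (Some c) tp tp2 (t1 + t2).
Proof.
elim=> {c tp tp1 t1} [c tp x E|c c' tp tp' x t E _ IH] H.
  by rewrite add1n; apply: run_step H; rewrite /= E.
by rewrite addSn; apply: run_step (IH H); rewrite /= E.
Qed.

(** Only the cells from the head on count. A pop leaves its symbol behind on the left, and a push
    moves onto such a stale cell before overwriting it. The trailing blanks allow pops from an empty
    stack. *)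
Definition holds_word (tp : tape) (w : seq bool) : Prop :=
  exists z, tp.2 = map Some w ++ nseq z None.

Definition holds_stacks (tp : tapes) (s : stacks) : Prop :=
  forall j : 'I_T.+1, holds_word (tp j) (s j).

Lemma tape_read_word tp w : holds_word tp w -> tape_read tp = ohead w.
Proof. by case=> z; rewrite /tape_read => ->; case: w => //; case: z. Qed.

Lemma holds_stay tp w : holds_word tp w ->
  holds_word (tape_act tp (tape_read tp, MoveS)) w.
Proof.
case: tp => l r [z /= E]; rewrite /holds_word /tape_read /= E.
case: w {E} => [|a w] /=; last by exists z.
by case: z => [|z]; [exists 1 | exists z.+1].
Qed.

Lemma holds_pop tp w : holds_word tp w ->
  holds_word (tape_act tp (tape_read tp, MoveR)) (behead w).
Proof.
case: tp => l r [z /= E]; rewrite /holds_word /= E.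
case: w {E} => [|a w] /=; last by exists z.
by exists z.-1; case: z.
Qed.

Lemma holds_push tp w b : holds_word tp w ->
  let tp1 := tape_act tp (tape_read tp, MoveL) in
  holds_word (tape_act tp1 (Some b, MoveS)) (b :: w).
Proof.
move=> /holds_stay; case: tp => l r [z /= E]; rewrite /holds_word /=.
by exists z; rewrite E.
Qed.

Lemma stay_all tp s : holds_stacks tp s ->
  holds_stacks (act_all tp (stay (read_all tp))) s.
Proof. by move=> H j; rewrite /act_all /stay ffunE; apply: holds_stay. Qed.

Lemma read_allE tp s i : holds_stacks tp s -> i <= T ->
  read_all tp (inord i) = ohead (s i).
Proof. by move=> H iT; rewrite ffunE (tape_read_word (H _)) inordK. Qed.

Lemma exec_run p s s' t : exec p s s' t -> stacks_below T p ->
  forall tp, holds_stacks tp s ->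
  exists2 tp', holds_stacks tp' s' & @run p (entry p) tp tp' t.
Proof.
elim=> {p s s' t}.
- move=> i b s _ tp H; eexists; last first.
    by apply: run_step; [reflexivity | apply: run_exit; reflexivity].
  move=> j; rewrite /act_all /act_on /upd /= !ffunE /=.
  case: eqP => [E|_]; first by rewrite -E; apply: holds_push.
  by apply/holds_stay/holds_stay.
- move=> i s _ tp H; eexists; last by apply: run_exit; reflexivity.
  move=> j; rewrite /act_all /act_on /upd /=; case: eqP => [E|_]; rewrite ffunE.
    by rewrite -E; apply: holds_pop.
  exact: holds_stay.
- move=> p q s s1 s2 t1 t2 _ IH1 _ IH2 /= /andP[w1 w2] tp H.
  have [tp1 H1 r1] := IH1 w1 _ H; have [tp2 H2 r2] := IH2 w2 _ H1.
  by exists tp2 => //; apply: run_seq1 r1 r2.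
- move=> i c p q s s1 t Hc _ IH /= /and3P[iT w1 w2] tp H.
  have [tp1 H1 r1] := IH w1 _ (stay_all H).
  exists tp1 => //; apply: run_step (run_if1 _ _ _ r1).
  by rewrite /= (read_allE H) // Hc.
- move=> i c p q s s1 t Hc _ IH /= /and3P[iT w1 w2] tp H.
  have [tp1 H1 r1] := IH w2 _ (stay_all H).
  exists tp1 => //; apply: run_step (run_if2 _ _ _ r1).
  by rewrite /= (read_allE H) // (negbTE Hc).
- move=> i c p s Hc /= /andP[iT _] tp H.
  exists (act_all tp (stay (read_all tp))); first exact: stay_all.
  by apply: run_exit; rewrite /= (read_allE H) // (negbTE Hc).
- move=> i c p s s1 s2 t1 t2 Hc _ IH1 _ IH2 /= w tp H.
  have /andP[iT w1] := w.
  have [tp1 H1 r1] := IH1 w1 _ (stay_all H).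
  have [tp2 H2 r2] := IH2 w _ H1.
  exists tp2 => //; apply: run_step (run_while r1 r2).
  by rewrite /= (read_allE H) // Hc.
Qed.

Definition machine (p : sprog) : tm :=
  @TM (option (ctrl p)) T (Some (entry p)) (fun c => c == None)
    (fun c f => if c is Some c1 then trans c1 f else (None, stay f)).

Lemma run_iter p c tp tp' t : @run p c tp tp' t ->
  iter t (@tm_step (machine p)) (Some c, tp) = (None, tp').
Proof.
elim=> {c tp tp' t} [c tp x E|c c' tp tp' x t E _ IH].
  by rewrite /= /tm_step /= -/(read_all tp) E.
by rewrite iterSr -IH /= /tm_step /= -/(read_all tp) E.
Qed.

Lemma iter_halt (M : tm) (c : tm_config M) t :
  tm_halt c.1 -> iter t (@tm_step M) c = c.
Proof. by move=> h; elim: t => //= t ->; rewrite /tm_step h. Qed.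

Lemma holds_wordE tp w : holds_word tp w -> word_of_tape tp = w.
Proof.
case=> z; rewrite /word_of_tape => ->.
by elim: w => [|b w /= ->] //; case: z.
Qed.

Lemma machine_outputs p ws s t t' :
  stacks_below T p -> exec p (fun i => nth [::] ws i) s t -> t <= t' ->
  tm_outputs_within (machine p) ws (s T) t'.
Proof.
move=> w ex tt'; rewrite /tm_outputs_within.
have H : holds_stacks (tm_init (machine p) ws).2 (fun i => nth [::] ws i).
  by move=> j; exists 0; rewrite /= cats0.
have [tp' H' r] := exec_run ex w H.
rewrite -(subnK tt') iterD.
have -> : iter t (@tm_step (machine p)) (tm_init (machine p) ws) = (None, tp').
  exact: run_iter r.
rewrite iter_halt //=; split => //.
exact: (holds_wordE (H' ord_max)).
Qed.

End Machine.

(** * Bounded arithmetic expressions *)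

Inductive expr :=
| Var of nat
| Cst of nat
| Add of expr & expr
| Sub of expr & expr
| Mul of expr & expr
| Sum of nat & expr & expr
| Let of nat & expr & expr
| Pow of expr & expr
| Bit of bool & expr.

(* [Pow a b] is cut off at [b] so that values stay polynomial in the inputs. *)
Fixpoint expr_val (inp : bool -> seq bool) (e : expr) (env : nat -> nat) : nat :=
  match e with
  | Var v => env v
  | Cst c => c
  | Add a b => expr_val inp a env + expr_val inp b env
  | Sub a b => expr_val inp a env - expr_val inp b env
  | Mul a b => expr_val inp a env * expr_val inp b env
  | Sum x a b => \sum_(i < expr_val inp a env) expr_val inp b (upd env x (i : nat))
  | Let x a b => expr_val inp b (upd env x (expr_val inp a env))
  | Pow a b => minn (2 ^ expr_val inp a env) (expr_val inp b env)
  | Bit w a => nth false (inp w) (expr_val inp a env)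
  end.

Notation un := (fun a => nseq a true).
Definition nonblank (o : option bool) : bool := if o is Some _ then true else false.
Definition is_one (o : option bool) : bool := if o is Some b then b else false.

Notation "p ;; q" := (Seq p q) (at level 61, right associativity).

Definition loop (i : nat) (p : sprog) := While i nonblank (Pop i ;; p).
Definition clear (i : nat) := While i nonblank (Pop i).
Definition mv (i j : nat) := loop i (Push j true).
Definition copy (i j k : nat) :=
  loop i (Push j true ;; Push k true) ;; mv k i.
Definition mvbit (i j : nat) :=
  If i is_one (Pop i ;; Push j true) (Pop i ;; Push j false).
Definition mvbits (i j : nat) := While i nonblank (mvbit i j).
(** [Pop] on an empty stack serves as the skip instruction, here and in [compile]. *)
Fixpoint pushes (c d : nat) : sprog :=
  if c is c'.+1 then pushes c' d ;; Push d true else Pop d.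

Definition word_reg (w : bool) : nat := if w then 4 else 3.

(** The result is left in unary on stack [d]; stacks from [d] on are scratch, empty before and,
    apart from the result, empty after. In [Pow] every unit copied back to [d] while doubling
    consumes one unit of the cap on [d.+2], which is parked on [d.+4] and then restored. In [Bit]
    the skipped prefix of the word is moved aside to [d.+2] and put back. *)
Fixpoint compile (e : expr) (rho : nat -> nat) (d : nat) : sprog :=
  match e with
  | Var v => copy (rho v) d d.+1
  | Cst c => pushes c d
  | Add a b => compile a rho d ;; compile b rho d.+1 ;; mv d.+1 d
  | Sub a b => compile a rho d ;; compile b rho d.+1 ;; loop d.+1 (Pop d)
  | Mul a b => compile a rho d.+1 ;; compile b rho d.+2 ;;
      loop d.+1 (copy d.+2 d d.+3) ;; clear d.+2
  | Sum x a b => compile a rho d.+1 ;;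
      loop d.+1 (compile b (upd rho x d.+1) d.+2 ;; mv d.+2 d)
  | Let x a b => compile a rho d ;; compile b (upd rho x d) d.+1 ;;
      clear d ;; mv d.+1 d
  | Pow a b => compile a rho d.+1 ;; compile b rho d.+2 ;;
      If d.+2 nonblank (Push d true) (Pop d) ;;
      loop d.+1 (loop d (Push d.+3 true ;; Push d.+3 true) ;;
        loop d.+3 (If d.+2 nonblank
          (Pop d.+2 ;; Push d.+4 true ;; Push d true) (Pop d.+2)) ;;
        mv d.+4 d.+2) ;;
      clear d.+2
  | Bit w a => compile a rho d.+1 ;;
      loop d.+1 (If (word_reg w) nonblank (mvbit (word_reg w) d.+2)
                    (Pop (word_reg w))) ;;
      If (word_reg w) is_one (Push d true) (Pop d) ;;
      mvbits d.+2 (word_reg w)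
  end.

(** * Correctness and running time of the compiled code *)

Definition execb (p : sprog) (s s' : stacks) (b : nat) : Prop :=
  exists2 t, t <= b & exec p s s' t.

Lemma execb_weak p s s1 s2 b c :
  execb p s s1 b -> s1 = s2 -> b <= c -> execb p s s2 c.
Proof. by move=> [t tb ex] <- bc; exists t => //; apply: leq_trans bc. Qed.

Lemma execb_push i b s s' : s' = upd s i (b :: s i) -> execb (Push i b) s s' 2.
Proof. by move=> ->; exists 2 => //; constructor. Qed.

Lemma execb_pop i s s' : s' = upd s i (behead (s i)) -> execb (Pop i) s s' 1.
Proof. by move=> ->; exists 1 => //; constructor. Qed.

Lemma execb_seq s1 p q s s2 b1 b2 :
  execb p s s1 b1 -> execb q s1 s2 b2 -> execb (p ;; q) s s2 (b1 + b2).
Proof.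
move=> [t1 h1 e1] [t2 h2 e2]; exists (t1 + t2); first exact: leq_add.
exact: exec_seq e1 e2.
Qed.

Lemma execb_if (c : option bool -> bool) i p q s s' b :
  (c (ohead (s i)) -> execb p s s' b) -> (~~ c (ohead (s i)) -> execb q s s' b) ->
  execb (If i c p q) s s' b.+1.
Proof.
move=> H1 H2; case: (boolP (c (ohead (s i)))) => h.
  by case: (H1 h) => t tb ex; exists t.+1 => //; apply: exec_ifT.
by case: (H2 h) => t tb ex; exists t.+1 => //; apply: exec_ifF.
Qed.

(** The invariant [f k] is indexed by the number of iterations left; the body starts with its
    counter already decremented, and the test and the pop account for the 2. *)
Lemma execb_loop i p (f : nat -> stacks) a b :
  (forall k, k <= a -> f k i = un k) ->
  (forall k, k < a -> execb p (upd (f k.+1) i (un k)) (f k) b) ->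
  execb (loop i p) (f a) (f 0) (a * (b + 2) + 1).
Proof.
move=> fi H.
elim: a fi H => [|a IH] fi H.
  by exists 1 => //; apply: exec_whileF; rewrite fi.
have [t1 h1 e1] := H a (leqnn _).
have [||t2 h2 e2] := IH; first by move=> k h; apply: fi; lia.
  by move=> k h; apply: H; lia.
exists ((1 + t1) + t2).+1; first by lia.
apply: exec_whileT e2; first by rewrite fi.
apply: exec_seq e1; have := exec_pop i (f a.+1).
by rewrite fi.
Qed.

Ltac st_eq := apply/funext => ?; rewrite /upd /=;
  repeat (case: eqP => ?; subst; rewrite /=); try lia; try done.

Ltac reg := rewrite /upd /=; repeat (case: eqP => ?; subst; rewrite /=); try lia; try done.

Lemma execb_clear i s a : s i = un a ->
  execb (clear i) s (upd s i [::]) (a * 2 + 1).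
Proof.
elim: a s => [|a IH] s si.
  exists 1 => //; have -> : upd s i [::] = s by st_eq; rewrite si.
  by apply: exec_whileF; rewrite si.
have [|t ht e] := IH (upd s i (un a)); first by reg.
exists (1 + t).+1; first by lia.
have -> : upd s i [::] = upd (upd s i (un a)) i [::] by st_eq.
apply: exec_whileT e; first by rewrite si.
by have := exec_pop i s; rewrite si.
Qed.

Lemma execb_mv i j s a b : i != j -> s i = un a -> s j = un b ->
  execb (mv i j) s (upd (upd s i [::]) j (un (a + b))) (a * 4 + 1).
Proof.
move=> /eqP ij si sj.
pose f k := upd (upd s i (un k)) j (un (a - k + b)).
have -> : s = f a by rewrite /f; st_eq; rewrite ?si ?sj ?subnn.
apply: (execb_weak (s1 := f 0) (b := a * (2 + 2) + 1)).
- apply: execb_loop => [k h|k h]; first by rewrite /f; reg.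
  apply: execb_push; rewrite /f; st_eq.
  by have -> : a - k = (a - k.+1).+1 by lia.
- by rewrite /f; st_eq; rewrite subn0.
- by lia.
Qed.

Lemma execb_copy i j k s a b : i != j -> i != k -> j != k ->
  s i = un a -> s j = un b -> s k = [::] ->
  execb (copy i j k) s (upd s j (un (a + b))) (a * 10 + 2).
Proof.
move=> /eqP ij /eqP ik /eqP jk si sj sk.
pose f c := upd (upd (upd s i (un c)) j (un (a - c + b))) k (un (a - c)).
have {1}-> : s = f a by rewrite /f; st_eq; rewrite ?si ?sj ?subnn.
apply: (execb_weak (s1 := upd (upd (f 0) k [::]) i (un (a + 0)))
  (b := (a * (4 + 2) + 1) + (a * 4 + 1))).
- apply: execb_seq.
    apply: execb_loop => [c h|c h]; first by rewrite /f; reg.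
    apply: (execb_seq (b1 := 2) (b2 := 2)); apply: execb_push; first reflexivity.
    rewrite /f; st_eq; try by have -> : a - c = (a - c.+1).+1 by lia.
  apply: execb_mv; rewrite /f; reg.
  by rewrite subn0.
- by rewrite /f; st_eq; rewrite ?subn0 ?addn0 // si.
- by lia.
Qed.

Lemma execb_pushes c d s : s d = [::] -> execb (pushes c d) s (upd s d (un c)) (c * 2 + 1).
Proof.
move=> sd; elim: c => [|c IH] /=.
  by apply: execb_pop; rewrite sd.
apply: execb_weak (execb_seq IH (execb_push _)) _ _; [reflexivity | st_eq | lia].
Qed.

Lemma execb_mvbit i j s b w : i != j -> s i = b :: w ->
  execb (mvbit i j) s (upd (upd s i w) j (b :: s j)) 4.
Proof.
move=> /eqP ij si; apply: execb_if; rewrite si /= => hb.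
  apply: (execb_seq (b1 := 1) (b2 := 2) (s1 := upd s i w)).
    by apply: execb_pop; rewrite si.
  by apply: execb_push; st_eq; rewrite hb.
apply: (execb_seq (b1 := 1) (b2 := 2) (s1 := upd s i w)).
  by apply: execb_pop; rewrite si.
by apply: execb_push; st_eq; rewrite (negbTE hb).
Qed.

Lemma execb_mvbits i j s : i != j ->
  execb (mvbits i j) s (upd (upd s i [::]) j (catrev (s i) (s j)))
    (size (s i) * 5 + 1).
Proof.
move=> ij; have /eqP ij' := ij.
move E: (s i) => w; elim: w s E => [|b w IH] s si.
  exists 1 => //; have -> : upd (upd s i [::]) j (catrev [::] (s j)) = s.
    by st_eq; rewrite si.
  by apply: exec_whileF; rewrite si.
have [t1 h1 e1] := execb_mvbit ij si.
have [|t2 h2 e2] := IH (upd (upd s i w) j (b :: s j)); first by reg.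
exists (t1 + t2).+1; first by rewrite /=; lia.
have -> : upd (upd s i [::]) j (catrev (b :: w) (s j)) =
  upd (upd (upd (upd s i w) j (b :: s j)) i [::]) j
    (catrev w (upd (upd s i w) j (b :: s j) j)) by st_eq.
by apply: exec_whileT e1 e2; rewrite si.
Qed.

Definition layout (inp : bool -> seq bool) (env rho : nat -> nat) (d : nat)
    (s : stacks) : Prop :=
  [/\ forall v, rho v < d /\ s (rho v) = un (env v),
      forall w, s (word_reg w) = inp w, 4 < d & forall j, d <= j -> s j = [::]].

Lemma layoutS inp env rho d s a : layout inp env rho d s ->
  layout inp env rho d.+1 (upd s d (un a)).
Proof.
case=> H1 H2 d4 H3; split.
- move=> v; have [h1 h2] := H1 v; split; first by lia.
  by rewrite /upd; case: eqP => // E; lia.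
- by move=> w; rewrite -H2 /upd; case: eqP => // E; case: w E => /=; lia.
- by lia.
- by move=> j h; rewrite /upd; case: eqP => [|_]; [lia | apply: H3; lia].
Qed.

Lemma layout_let inp env rho d s x a : layout inp env rho d s ->
  layout inp (upd env x a) (upd rho x d) d.+1 (upd s d (un a)).
Proof.
move=> /(@layoutS _ _ _ _ _ a)[H1 H2 H3 H4]; split => //.
move=> v; rewrite {1 3 4}/upd; case: eqP => [_|_]; last exact: H1.
by split; [lia | rewrite /upd eqxx].
Qed.

(** One number bounds both the value and the time, and it depends only on the bound [N] for the
    variables: reading bit number a touches at most a symbols of a word, so word lengths do not
    enter. *)
Definition good_code (e : expr) (N : nat) (T : nat) : Prop :=
  forall inp env rho d s, (forall v, env v <= N) -> layout inp env rho d s ->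
    expr_val inp e env <= T /\
    execb (compile e rho d) s (upd s d (un (expr_val inp e env))) T.

Lemma good_code_weak e N T T' : T <= T' -> good_code e N T -> good_code e N T'.
Proof.
move=> h H inp env rho d s H1 H2; have [h1 h2] := H _ _ _ _ _ H1 H2.
by split; [lia | apply: execb_weak h2 _ _].
Qed.

Lemma good_var v N : good_code (Var v) N (N * 10 + 2).
Proof.
move=> inp env rho d s H1 [H2 H3 d4 H4] /=; have h := H1 v.
have [h1 h2] := H2 v.
split; first by lia.
apply: execb_weak (execb_copy (i := rho v) (j := d) (k := d.+1) _ _ _ h2 (b := 0) _ _) _
  _ => //.
- by lia.
- by lia.
- by lia.
- by rewrite H4.
- by rewrite H4.
- by rewrite addn0.
- by lia.
Qed.

Lemma good_cst c N : good_code (Cst c) N (c * 2 + 1).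
Proof.
move=> inp env rho d s H1 [H2 H3 d4 H4] /=; split; first by lia.
by apply: execb_pushes; rewrite H4.
Qed.

Lemma good_add a b N T : good_code a N T -> good_code b N T ->
  good_code (Add a b) N (T * 6 + 1).
Proof.
move=> Ha Hb inp env rho d s H1 Hs /=.
have [va ea] := Ha _ _ _ _ _ H1 Hs.
have [vb eb] := Hb _ _ _ _ _ H1 (layoutS (expr_val inp a env) Hs).
have [_ _ d4 H4] := Hs.
split; first by lia.
apply: execb_weak (execb_seq ea (execb_seq eb (execb_mv
  (a := expr_val inp b env) (b := expr_val inp a env) _ _ _))) _ _.
- by lia.
- by reg.
- by reg.
- st_eq; [by rewrite addnC | by rewrite H4].
- by lia.
Qed.

Lemma good_sub a b N T : good_code a N T -> good_code b N T ->
  good_code (Sub a b) N (T * 6 + 1).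
Proof.
move=> Ha Hb inp env rho d s H1 Hs /=.
have [va ea] := Ha _ _ _ _ _ H1 Hs.
have [vb eb] := Hb _ _ _ _ _ H1 (layoutS (expr_val inp a env) Hs).
have [_ _ d4 H4] := Hs.
split; first by lia.
move: (expr_val inp a env) (expr_val inp b env) va vb ea eb => x y vx vy ea eb.
pose f k := upd (upd s d (un (x - (y - k)))) d.+1 (un k).
apply: execb_weak (execb_seq ea (execb_seq eb
  (_ : execb _ _ (f 0) (y * (1 + 2) + 1)))) _ _.
- have -> : upd (upd s d (un x)) d.+1 (un y) = f y.
    by rewrite /f; st_eq; rewrite subnn subn0.
  apply: execb_loop => k h; first by rewrite /f; reg.
  apply: execb_pop; rewrite /f; st_eq.
  have -> : x - (y - k) = (x - (y - k.+1)).-1 by lia.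
  by case: (x - _).
- by rewrite /f; st_eq; rewrite ?subn0 // H4.
- by lia.
Qed.

Lemma good_mul a b N T : good_code a N T -> good_code b N T ->
  good_code (Mul a b) N (T * T * 10 + T * 8 + 2).
Proof.
move=> Ha Hb inp env rho d s H1 Hs /=.
have [_ _ d4 H4] := Hs.
have Hs0 := layoutS 0 Hs.
have s0 : upd s d (un 0) = s by st_eq; rewrite H4.
have [va ea] := Ha _ _ _ _ _ H1 Hs0.
have [vb eb] := Hb _ _ _ _ _ H1 (layoutS (expr_val inp a env) Hs0).
rewrite s0 in ea eb.
split; first by nia.
move: (expr_val inp a env) (expr_val inp b env) va vb ea eb => x y vx vy ea eb.
pose f k := upd (upd (upd s d (un ((x - k) * y))) d.+1 (un k)) d.+2 (un y).
apply: execb_weak (execb_seq ea (execb_seq eb (execb_seq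
  (_ : execb _ _ (f 0) (x * (y * 10 + 2 + 2) + 1))
  (execb_clear (a := y) _)))) _ _.
- have -> : upd (upd s d.+1 (un x)) d.+2 (un y) = f x.
    by rewrite /f; st_eq; rewrite subnn H4.
  apply: execb_loop => k h; first by rewrite /f; reg.
  apply: execb_weak (execb_copy (a := y) (b := (x - k.+1) * y) _ _ _ _ _ _) _ _;
    rewrite /f; try by reg.
    by reg; rewrite H4 //; lia.
  by st_eq; congr nseq; nia.
- by rewrite /f; reg.
- rewrite /f; st_eq; rewrite ?subn0 //; rewrite H4 //; lia.
- by nia.
Qed.

Lemma good_sum x a b N T T' : T >= N -> T' >= T -> good_code a N T -> good_code b T T' ->
  good_code (Sum x a b) N (T' * T' * 5 + T' * 5 + 1).
Proof.
move=> NT TT' Ha Hb inp env rho d s H1 Hs /=.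
have [_ _ d4 H4] := Hs.
have Hs0 := layoutS 0 Hs.
have s0 : upd s d (un 0) = s by st_eq; rewrite H4.
have [va ea] := Ha _ _ _ _ _ H1 Hs0.
rewrite s0 in ea.
move: (expr_val inp a env) va ea => y vy ea.
pose g (i : nat) := expr_val inp b (upd env x i).
have Hg (i : nat) acc : i < y -> g i <= T' /\
  execb (compile b (upd rho x d.+1) d.+2) (upd (upd s d (un acc)) d.+1 (un i))
   (upd (upd (upd s d (un acc)) d.+1 (un i)) d.+2 (un (g i))) T'.
  move=> iy; apply: Hb; last exact/layout_let/layoutS.
  by move=> v; rewrite /upd; case: eqP => _; [lia | have := H1 v; lia].
have sum_le : \sum_(i < y) g i <= y * T'.
  rewrite -[X in X * _]card_ord -sum_nat_const; apply: leq_sum => i _.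
  by have [] := Hg i 0 (ltn_ord i).
split; first by apply: leq_trans sum_le _; nia.
pose f k := upd (upd s d (un (\sum_(k <= i < y) g i))) d.+1 (un k).
apply: execb_weak (execb_seq ea
  (_ : execb _ _ (f 0) (y * (T' + (T' * 4 + 1) + 2) + 1))) _ _.
- have -> : upd s d.+1 (un y) = f y.
    by rewrite /f; st_eq; rewrite big_geq // H4.
  apply: execb_loop => k h; first by rewrite /f; reg.
  pose acc := \sum_(k.+1 <= i < y) g i.
  have [h1 h2] := Hg k acc h.
  have -> : upd (f k.+1) d.+1 (un k) = upd (upd s d (un acc)) d.+1 (un k).
    by rewrite /f; st_eq.
  apply: execb_weak (execb_seq h2 (execb_mv (a := g k) (b := acc) _ _ _)) _ _.
  + by lia.
  + by reg.
  + by reg.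
  + rewrite /f; st_eq; last by rewrite H4 //; lia.
    by rewrite (big_ltn h).
  + by lia.
- by rewrite /f big_mkord; st_eq; rewrite H4.
- by nia.
Qed.

Lemma good_let x a b N T T' : T >= N -> T' >= T -> good_code a N T -> good_code b T T' ->
  good_code (Let x a b) N (T' * 8 + 2).
Proof.
move=> NT TT' Ha Hb inp env rho d s H1 Hs /=.
have [_ _ d4 H4] := Hs.
have [va ea] := Ha _ _ _ _ _ H1 Hs.
move: (expr_val inp a env) va ea => y vy ea.
have [|vb eb] := Hb _ _ _ _ _ _ (layout_let x y Hs).
  by move=> v; rewrite /upd; case: eqP => _; [lia | have := H1 v; lia].
move: (expr_val inp b _) vb eb => z vz eb.
split; first by lia.
apply: execb_weak (execb_seq ea (execb_seq eb (execb_seq (execb_clear (a := y) _)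
  (execb_mv (a := z) (b := 0) _ _ _)))) _ _; try by reg.
by st_eq; rewrite ?addn0 // H4.
Qed.

Lemma good_bit w a N T : good_code a N T -> good_code (Bit w a) N (T * 13 + 6).
Proof.
move=> Ha inp env rho d s H1 Hs /=.
have [_ Hw d4 H4] := Hs.
have Hs0 := layoutS 0 Hs.
have s0 : upd s d (un 0) = s by st_eq; rewrite H4.
have [va ea] := Ha _ _ _ _ _ H1 Hs0.
rewrite s0 in ea.
move: (expr_val inp a env) va ea => y vy ea.
split; first by case: nth => /=; lia.
move: (Hw w); set r := word_reg w; set W := inp w => sr.
have rd : r < d by rewrite /r; case: w {sr W r} => /=; lia.
pose f k := upd (upd (upd s d.+1 (un k)) r (drop (y - k) W)) d.+2 (rev (take (y - k) W)).
pose bs := un (nat_of_bool (nth false W y)).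
apply: execb_weak (execb_seq ea (execb_seq
  (_ : execb _ _ (f 0) (y * (5 + 2) + 1)) (execb_seq
  (_ : execb _ _ (upd (f 0) d bs) 3) (execb_mvbits _ _)))) _ _.
- have -> : upd s d.+1 (un y) = f y.
    by rewrite /f; st_eq; rewrite ?subnn ?take0 ?drop0 ?sr // H4 //; lia.
  apply: execb_loop => k h; first by rewrite /f; reg.
  have E : y - k = (y - k.+1).+1 by lia.
  have Er : upd (f k.+1) d.+1 (un k) r = drop (y - k.+1) W by rewrite /f; reg.
  apply: execb_if; rewrite Er.
  + case D: (drop (y - k.+1) W) => [//|b V] _.
    apply: execb_weak (execb_mvbit _ (b := b) (w := V) _) _ (leqnn _).
    * by lia.
    * by rewrite /f; reg.
    * have sz : y - k.+1 < size W.
        by rewrite ltnNge; apply/negP => /drop_oversize; rewrite D.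
      have Eb : nth false W (y - k.+1) = b.
        by rewrite -{1}(addn0 (y - k.+1)) -nth_drop D.
      rewrite /f; st_eq.
        by rewrite E (take_nth false sz) rev_rcons.
      by rewrite E -add1n -drop_drop D /= drop0.
  (* Past the end of the word the pop is a skip, and [take] and [drop] no longer change. *)
  + case D: (drop (y - k.+1) W) => [|//] _.
    apply: execb_weak (execb_pop _) (erefl _) _ => //.
    have sz : size W <= y - k.+1 by rewrite -subn_eq0 -size_drop D.
    rewrite /f; st_eq; rewrite ?take_oversize ?drop_oversize //; lia.
- have Er : f 0 r = drop y W by rewrite /f subn0; reg.
  apply: execb_if; rewrite Er.
  + move=> h; apply: execb_push; rewrite /f /bs.
    have -> : nth false W y by move: h; rewrite -{2}(addn0 y) -nth_drop; case: drop.
    by st_eq; rewrite H4.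
  + move=> h; apply: execb_weak (execb_pop (erefl _)) _ _ => //.
    rewrite /f /bs.
    have -> : nth false W y = false.
      by move: h; rewrite -{2}(addn0 y) -nth_drop; case: drop => // b V /= /negbTE.
    by st_eq; rewrite H4.
- by lia.
- rewrite /f subn0; st_eq; first by rewrite catrevE revK cat_take_drop.
    by rewrite H4 //; lia.
  by rewrite H4 //; lia.
- have : size (upd (f 0) d bs d.+2) <= y.
    rewrite /f subn0; reg; rewrite size_rev size_take; case: ltnP => //; lia.
  by lia.
Qed.

Lemma good_pow a b N T : good_code a N T -> good_code b N T ->
  good_code (Pow a b) N (T * T * 30 + T * 20 + 12).
Proof.
move=> Ha Hb inp env rho d s H1 Hs /=.
have [_ _ d4 H4] := Hs.
have Hs0 := layoutS 0 Hs.
have s0 : upd s d (un 0) = s by st_eq; rewrite H4.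
have [va ea] := Ha _ _ _ _ _ H1 Hs0.
have [vb eb] := Hb _ _ _ _ _ H1 (layoutS (expr_val inp a env) Hs0).
rewrite s0 in ea eb.
move: (expr_val inp a env) (expr_val inp b env) va vb ea eb => x c vx vc ea eb.
split; first by rewrite geq_min; nia.
pose f k := upd (upd (upd s d (un (minn (2 ^ (x - k)) c))) d.+1 (un k)) d.+2 (un c).
have fx : upd (f x) d (un (minn 1 c)) = f x by rewrite /f; st_eq; rewrite subnn.
apply: execb_weak (execb_seq ea (execb_seq eb (execb_seq
  (_ : execb _ _ (f x) 3) (execb_seq
  (_ : execb _ _ (f 0) (x * ((c * 6 + 1) + ((c * 2) * 8 + 1 + (c * 4 + 1)) + 2) + 1))
  (execb_clear (a := c) _))))) _ _.
- apply: execb_if.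
  + have -> : upd (upd s d.+1 (un x)) d.+2 (un c) d.+2 = un c by reg.
    case: c vc eb @f fx => [//|c] vc eb f fx _; apply: execb_push.
    by rewrite /f; st_eq; rewrite subnn expn0 H4 //; have -> : minn 1 c.+1 = 1 by lia.
  + have -> : upd (upd s d.+1 (un x)) d.+2 (un c) d.+2 = un c by reg.
    case: c vc eb @f fx => [|//] vc eb f fx _;
      apply: execb_weak (execb_pop (erefl _)) _ _ => //.
    rewrite /f minn0; st_eq; rewrite ?minn0 H4 //.
- apply: execb_loop => k h; first by rewrite /f; reg.
  set v := minn (2 ^ (x - k.+1)) c.
  have vc' : v <= c by rewrite geq_min leqnn orbT.
  have vE : minn (2 ^ (x - k)) c = minn (v + v) c.
    have -> : x - k = (x - k.+1).+1 by lia.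
    by rewrite /v expnS; move: (2 ^ _) => w; lia.
  pose g u := upd (upd (upd s d.+1 (un k)) d.+2 (un c)) d (un u).
  pose g1 u := upd (g u) d.+3 (un ((v - u) + (v - u))).
  have E1 : upd (f k.+1) d.+1 (un k) = g1 v.
    by rewrite /f /g1 /g; st_eq; rewrite subnn H4 //; lia.
  (* With [u] units of the doubled value left, [q] have been handled; [minn q c] of them reached
     [d], each against one unit of the cap now parked on [d.+4]. *)
  pose g2 u := let q := (v + v) - u in
    upd (upd (upd (upd (upd s d.+1 (un k)) d.+2 (un (c - q))) d (un (minn q c)))
      d.+4 (un (minn q c))) d.+3 (un u).
  have E2 : g1 0 = g2 (v + v).
    rewrite /g1 /g2 /g !subn0 subnn min0n; st_eq; rewrite ?subn0 // H4 //; lia.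
  rewrite E1.
  apply: execb_weak (execb_seq (_ : execb _ _ (g1 0) (v * (4 + 2) + 1))
    (execb_seq (_ : execb _ _ (g2 0) ((v + v) * (6 + 2) + 1))
    (execb_mv (a := minn (v + v) c) (b := c - (v + v)) _ _ _))) _ _.
  + apply: execb_loop => u hu; first by rewrite /g1 /g; reg.
    apply: (execb_seq (b1 := 2) (b2 := 2)); apply: execb_push; first reflexivity.
    rewrite /g1 /g; st_eq; try by rewrite H4 //; lia.
    have -> : v - u = (v - u.+1).+1 by lia.
    by rewrite addSn addnS.
  + rewrite E2; apply: execb_loop => u hu; first by rewrite /g2; reg.
    set q := v + v - u.+1.
    have Eq : v + v - u = q.+1 by rewrite /q; lia.
    have Er : upd (g2 u.+1) d.+3 (un u) d.+2 = un (c - q) by rewrite /g2 -/q; reg.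
    apply: execb_if; rewrite Er.
    * case D: (c - q) => [//|z] _.
      apply: execb_weak (execb_seq (execb_pop (erefl _))
        (execb_seq (execb_push (erefl _)) (execb_push (erefl _)))) _ _ => //.
      rewrite /g2 Eq -/q; st_eq.
      - by have -> : minn q.+1 c = (minn q c).+1 by lia.
      - by have -> : minn q.+1 c = (minn q c).+1 by lia.
      - by rewrite D /=; congr nseq; lia.
    * case D: (c - q) => [|//] _.
      apply: execb_weak (execb_pop (erefl _)) _ _ => //.
      rewrite /g2 Eq -/q; st_eq.
      - by rewrite D /=; have -> : c - q.+1 = 0 by lia.
      - by congr nseq; lia.
      - by congr nseq; lia.
  + by lia.
  + by rewrite /g2 subn0; reg.
  + by rewrite /g2 subn0; reg.
  + rewrite /f /g2 subn0 vE; st_eq; try (by rewrite H4 //; lia).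
    by congr nseq; lia.
  + by move: vc'; move: (minn (v+v) c) (geq_minr (v + v) c) => z; lia.
- by rewrite /f; reg.
- rewrite /f subn0; st_eq; rewrite H4 //; lia.
- by nia.
Qed.

(** Each constructor costs at most 64 Y^2 when its parts cost at most Y, so multiplying the exponent
    by 8 absorbs it. *)
Lemma quadratic_le_exp8 Y : 2 <= Y -> 64 * (Y * Y) <= Y ^ 8.
Proof.
move=> h; rewrite (expnD Y 6 2) -mulnn leq_mul2r.
by apply/orP; right; rewrite -[64]/(2 ^ 6) leq_exp2r.
Qed.

Lemma good_code_poly e : exists2 c, 1 <= c & forall N, 2 <= N -> good_code e N (N ^ c).
Proof.
have pw N c : 1 <= c -> 2 <= N -> N <= N ^ c.
  by move=> h1 h2; rewrite -[X in X <= _]expn1 leq_pexp2l //; lia.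
have fin N c T : 1 <= c -> 2 <= N ->
   (forall Y, 2 <= Y -> Y = N ^ c -> T <= 64 * (Y * Y)) -> T <= N ^ (c * 8).
  move=> c1 N2 H; rewrite expnM; have h := pw N c c1 N2.
  by apply: leq_trans (quadratic_le_exp8 _); [apply: H | ]; lia.
have up N c1 c2 : 2 <= N -> N ^ c1 <= N ^ (c1 + c2) /\ N ^ c2 <= N ^ (c1 + c2).
  by move=> h; split; rewrite leq_pexp2l //; lia.
have both a b c1 c2 N : 1 <= c1 -> 2 <= N -> good_code a N (N ^ c1) ->
    good_code b N (N ^ c2) -> exists Y, [/\ 2 <= Y, Y = N ^ (c1 + c2),
      good_code a N Y & good_code b N Y].
  move=> h1 h2 Ha Hb; have [u1 u2] := up N c1 c2 h2.
  exists (N ^ (c1 + c2)); split => //.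
  - by have := pw N (c1 + c2); lia.
  - exact: good_code_weak u1 Ha.
  - exact: good_code_weak u2 Hb.
(* Under a binder the new variable may be as large as [N ^ c1], so the body is charged at that bound
   and exponents multiply. *)
have nest b c1 c2 N : 1 <= c1 -> 2 <= N -> (forall N, 2 <= N -> good_code b N (N ^ c2)) ->
    let Y := N ^ c1 in let Z := N ^ (c1 * c2.+1) in
    [/\ N <= Y, Y <= Z, 2 <= Z & good_code b Y Z].
  move=> h1 h2 H Y Z; have YN : N <= Y by apply: pw.
  have Y2 : 2 <= Y by lia.
  have ZE : Z = Y ^ c2.+1 by rewrite /Z expnM.
  have YZ : Y <= Z by rewrite ZE; apply: pw.
  split => //; [lia | apply: good_code_weak _ (H Y Y2)].
  by rewrite ZE leq_pexp2l //; lia.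
elim: e => [v|c|a [c1 h1 Ha] b [c2 h2 Hb]|a [c1 h1 Ha] b [c2 h2 Hb]
  |a [c1 h1 Ha] b [c2 h2 Hb]|x a [c1 h1 Ha] b [c2 h2 Hb]|x a [c1 h1 Ha] b [c2 h2 Hb]
  |a [c1 h1 Ha] b [c2 h2 Hb]|w a [c1 h1 Ha]].
- exists (1 * 8) => // N N2; apply: good_code_weak _ (@good_var v N).
  by apply: fin => // Y Y2; rewrite expn1 => ->; nia.
- exists (c.+1 * 8) => // N N2; apply: good_code_weak _ (@good_cst c N).
  apply: fin => // Y Y2 E.
  have : c < 2 ^ c by apply: ltn_expl.
  have : 2 ^ c <= Y.
    by rewrite E; apply: (@leq_trans (N ^ c)); [case: (c) => // c';
      rewrite leq_exp2r | rewrite leq_pexp2l //; lia].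
  by nia.
- exists ((c1 + c2) * 8) => [|N N2]; first by lia.
  have [Y [Y2 YE Ga Gb]] := both a b _ _ _ h1 N2 (Ha N N2) (Hb N N2).
  apply: good_code_weak _ (@good_add _ _ _ _ Ga Gb).
  by apply: fin => // [|Z Z2 ZE]; [lia | rewrite YE -ZE; nia].
- exists ((c1 + c2) * 8) => [|N N2]; first by lia.
  have [Y [Y2 YE Ga Gb]] := both a b _ _ _ h1 N2 (Ha N N2) (Hb N N2).
  apply: good_code_weak _ (@good_sub _ _ _ _ Ga Gb).
  by apply: fin => // [|Z Z2 ZE]; [lia | rewrite YE -ZE; nia].
- exists ((c1 + c2) * 8) => [|N N2]; first by lia.
  have [Y [Y2 YE Ga Gb]] := both a b _ _ _ h1 N2 (Ha N N2) (Hb N N2).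
  apply: good_code_weak _ (@good_mul _ _ _ _ Ga Gb).
  by apply: fin => // [|Z Z2 ZE]; [lia | rewrite YE -ZE; nia].
- exists ((c1 * c2.+1) * 8) => [|N N2]; first by lia.
  have [NY YZ Z2 Gb] := nest b c1 c2 N h1 N2 Hb.
  apply: good_code_weak _ (@good_sum _ _ _ _ _ _ NY YZ (Ha N N2) Gb).
  by apply: fin => // [|Z Z2' ZE]; [lia | rewrite -ZE; nia].
- exists ((c1 * c2.+1) * 8) => [|N N2]; first by lia.
  have [NY YZ Z2 Gb] := nest b c1 c2 N h1 N2 Hb.
  apply: good_code_weak _ (@good_let _ _ _ _ _ _ NY YZ (Ha N N2) Gb).
  by apply: fin => // [|Z Z2' ZE]; [lia | rewrite -ZE; nia].
- exists ((c1 + c2) * 8) => [|N N2]; first by lia.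
  have [Y [Y2 YE Ga Gb]] := both a b _ _ _ h1 N2 (Ha N N2) (Hb N N2).
  apply: good_code_weak _ (@good_pow _ _ _ _ Ga Gb).
  by apply: fin => // [|Z Z2 ZE]; [lia | rewrite YE -ZE; nia].
- exists (c1 * 8) => [|N N2]; first by lia.
  apply: good_code_weak _ (@good_bit w _ _ _ (Ha N N2)).
  by apply: fin => // Z Z2 ZE; rewrite -ZE; nia.
Qed.

Lemma compile_stacks e : exists h, forall rho d T, (forall v, rho v < d) ->
  4 < d -> d + h <= T -> stacks_below T (compile e rho d).
Proof.
have updl (rho : nat -> nat) d x r d' : (forall v, rho v < d) -> d <= d' -> r < d' ->
    forall v, upd rho x r v < d'.
  by move=> H h1 h2 v; rewrite /upd; case: eqP => _ //; have := H v; lia.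
have wkl (rho : nat -> nat) d d' : (forall v, rho v < d) -> d <= d' -> forall v, rho v < d'.
  by move=> H h1 v; have := H v; lia.
elim: e => [v|c|a [h1 Ha] b [h2 Hb]|a [h1 Ha] b [h2 Hb]
  |a [h1 Ha] b [h2 Hb]|x a [h1 Ha] b [h2 Hb]|x a [h1 Ha] b [h2 Hb]
  |a [h1 Ha] b [h2 Hb]|w a [h1 Ha]].
- by exists 2 => rho d T H d4 dT /=; have := H v; lia.
- exists 1 => rho d T H d4 dT /=; elim: c => [|c IH] /=; first by lia.
  by rewrite IH; lia.
- exists (h1 + h2 + 5) => rho d T H d4 dT /=.
  by rewrite Ha ?Hb //; try (by apply: wkl H _; lia); lia.
- exists (h1 + h2 + 5) => rho d T H d4 dT /=.
  by rewrite Ha ?Hb //; try (by apply: wkl H _; lia); lia.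
- exists (h1 + h2 + 5) => rho d T H d4 dT /=.
  by rewrite Ha ?Hb //; try (by apply: wkl H _; lia); lia.
- exists (h1 + h2 + 5) => rho d T H d4 dT /=.
  by rewrite Ha ?Hb //; try (by apply: wkl H _; lia); try (by apply: updl H _ _; lia); lia.
- exists (h1 + h2 + 5) => rho d T H d4 dT /=.
  by rewrite Ha ?Hb //; try (by apply: wkl H _; lia); try (by apply: updl H _ _; lia); lia.
- exists (h1 + h2 + 5) => rho d T H d4 dT /=.
  by rewrite Ha ?Hb //; try (by apply: wkl H _; lia); lia.
- exists (h1 + 5) => rho d T H d4 dT /=.
  by rewrite Ha //; try (by apply: wkl H _; lia); case: w => /=; lia.
Qed.

(** * Writing the output word *)

Definition env3 (o e n : nat) : nat -> nat :=
  fun v => match v with 0 => o | 1 => e | 2 => n | _ => 0 end.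

(* Stacks 0, 1, 2 hold k, m and ceil(log2(1/eps)), stacks 3 and 4 hold x and r,
   stack 5 is the output, stack 6 receives n = |x| and stack 7 stays empty. *)
Definition reg3 : nat -> nat :=
  fun v => match v with 0 => 1 | 1 => 2 | 2 => 6 | _ => 7 end.

(** Stack 1 starts at m and, once decremented, is the index o of the bit under computation. Bits
    appear from last to first, so that the stack spells the word in order. The parity is obtained by
    flipping the top of stack 5 once per unit of the value. *)
Definition emit_bits (e : expr) : sprog :=
  (While 3 nonblank (mvbit 3 8 ;; Push 6 true) ;; mvbits 8 3) ;;
  loop 1 (compile e reg3 8 ;; Push 5 false ;;
    loop 8 (If 5 is_one (Pop 5 ;; Push 5 false) (Pop 5 ;; Push 5 true))).

Lemma execb_count s x : s 3 = x -> s 6 = [::] -> s 8 = [::] ->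
  execb (While 3 nonblank (mvbit 3 8 ;; Push 6 true)) s
    (upd (upd (upd s 3 [::]) 6 (un (size x))) 8 (rev x)) (size x * 7 + 1).
Proof.
move=> s3 s6 s8.
have gen (w : seq bool) c (s0 : stacks) : s0 3 = w -> s0 6 = un c ->
  execb (While 3 nonblank (mvbit 3 8 ;; Push 6 true)) s0
    (upd (upd (upd s0 3 [::]) 6 (un (size w + c))) 8 (catrev w (s0 8))) (size w * 7 + 1).
  elim: w c s0 => [|b w IH] c s0 h3 h6.
    exists 1 => //.
    have -> : upd (upd (upd s0 3 [::]) 6 (un (size (Nil bool) + c))) 8 (catrev [::] (s0
      8)) = s0.
      by st_eq.
    by apply: exec_whileF; rewrite h3.
  have [|t1 l1 e1] := execb_seq (execb_mvbit (i := 3) (j := 8) _ h3)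
    (execb_push (i := 6) (b := true) (erefl _)) => //.
  have [||t2 l2 e2] := IH c.+1 (upd (upd (upd s0 3 w) 8 (b :: s0 8)) 6 (un c.+1)) => //.
  exists (t1 + t2).+1; first by rewrite /=; lia.
  apply: exec_whileT e1 _; first by rewrite h3.
  have -> : upd (upd (upd s0 3 w) 8 (b :: s0 8)) 6 (true :: upd (upd s0 3 w) 8 (b :: s0
    8) 6)
    = upd (upd (upd s0 3 w) 8 (b :: s0 8)) 6 (un c.+1) by rewrite /upd /= h6.
  have -> : upd (upd (upd s0 3 [::]) 6 (un (size (b :: w) + c))) 8 (catrev (b :: w) (s0 8))
    = upd (upd (upd (upd (upd (upd s0 3 w) 8 (b :: s0 8)) 6 (un c.+1)) 3 [::]) 6 (un
      (size w + c.+1))) 8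
     (catrev w (upd (upd (upd s0 3 w) 8 (b :: s0 8)) 6 (un c.+1) 8)).
    by st_eq; rewrite addnS.
  by [].
have := gen x 0 s s3 s6.
by rewrite addn0 s8.
Qed.

Lemma execb_parity s a : s 8 = un a ->
  execb (loop 8 (If 5 is_one (Pop 5 ;; Push 5 false) (Pop 5 ;; Push 5 true)))
    (upd s 5 (false :: s 5)) (upd (upd s 8 [::]) 5 (odd a :: s 5)) (a * 6 + 1).
Proof.
move=> s7.
pose f k := upd (upd s 8 (un k)) 5 (odd (a - k) :: s 5).
have -> : upd s 5 (false :: s 5) = f a by rewrite /f; st_eq; rewrite ?subnn.
have -> : upd (upd s 8 [::]) 5 (odd a :: s 5) = f 0 by rewrite /f subn0.
apply: execb_weak (execb_loop (f := f) (b := 4) _ _) _ _ => [k h|k h||]; last by lia.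
- by rewrite /f; reg.
- have Er : upd (f k.+1) 8 (un k) 5 = odd (a - k.+1) :: s 5 by rewrite /f; reg.
  have E : a - k = (a - k.+1).+1 by lia.
  by apply: execb_if; rewrite Er /= => hb;
    (apply: execb_weak (execb_seq (execb_pop (erefl _)) (execb_push (erefl _))) _ (leqnn
      _));
    rewrite /f E /=; st_eq; rewrite ?hb ?(negbTE hb).
- by [].
Qed.

(** Applied to the transposition of 5 and [T]: the output has to stand on the last tape, whose
    number depends on the compiled expression. *)
Fixpoint rename (g : nat -> nat) (p : sprog) : sprog :=
  match p with
  | Push i b => Push (g i) b
  | Pop i => Pop (g i)
  | Seq p q => Seq (rename g p) (rename g q)
  | If i c p q => If (g i) c (rename g p) (rename g q)
  | While i c p => While (g i) c (rename g p)
  end.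

Lemma exec_rename g p s s' t : involutive g -> exec p s s' t ->
  exec (rename g p) (s \o g) (s' \o g) t.
Proof.
move=> gg.
have updg (s0 : stacks) i w : upd s0 i w \o g = upd (s0 \o g) (g i) w.
  by apply/funext => j; rewrite /upd /= (can2_eq gg gg).
elim=> {p s s' t} /= [i b s|i s|p q s s1 s2 t1 t2 _ h1 _ h2|i c p q s s1 t hc _ h
  |i c p q s s1 t hc _ h|i c p s hc|i c p s s1 s2 t1 t2 hc _ h1 _ h2].
- by rewrite updg; have -> : s i = (s \o g) (g i) by [rewrite /= gg]; apply: exec_push.
- by rewrite updg; have -> : s i = (s \o g) (g i) by [rewrite /= gg]; apply: exec_pop.
- exact: exec_seq h1 h2.
- by apply: exec_ifT h; rewrite /= gg.
- by apply: exec_ifF h; rewrite /= gg.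
- by apply: exec_whileF; rewrite /= gg.
- by apply: exec_whileT h1 h2; rewrite /= gg.
Qed.

Lemma rename_below g T p : (forall i, i <= T -> g i <= T) ->
  stacks_below T p -> stacks_below T (rename g p).
Proof.
move=> H; elim: p => /= [i b|i|p IHp q IHq|i c p IHp q IHq|i c p IHp].
- exact: H.
- exact: H.
- by case/andP => /IHp -> /IHq.
- by case/and3P => /H -> /IHp -> /IHq.
- by case/andP => /H -> /IHp.
Qed.

Lemma tm_emits (ex : expr) : exists (M : tm) (c : nat), 
  forall (k m e : nat) (x r : seq bool),
    let ws := [:: un k; un m; un e; x; r] in
    tm_outputs_within M ws
      (mkseq (fun o => odd (expr_val (fun w : bool => if w then r else x) ex
                 (env3 o e (size x)))) m)
      (c * input_size ws ^ c + c).
Proof.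
have [c c1 Hc] := good_code_poly ex.
have [h Hh] := compile_stacks ex.
pose T := 9 + h.
pose g i := if i == 5 then T else if i == T then 5 else i.
have gg : involutive g.
  have T5 : (T == 5) = false by apply/eqP; rewrite /T; lia.
  move=> i; rewrite /g; case: (eqVneq i 5) => [->|n5]; first by rewrite T5 eqxx.
  by case: (eqVneq i T) => [->|nT]; rewrite ?eqxx // (negbTE n5) (negbTE nT).
exists (machine T (rename g (emit_bits ex))).
(* One number must serve as factor, exponent and additive term. For a nonempty input of size q, q +
   2 <= 3 q, which is where the powers of 3 come from; the additive term covers q = 0. *)
exists (3 ^ (c * 8 + 8)) => k m e x r ws.
pose N := input_size ws + 2.
have N2 : 2 <= N by rewrite /N; lia.
have G := Hc N N2.
pose inp := fun w : bool => if w then r else x.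
pose F o := odd (expr_val inp ex (env3 o e (size x))).
pose s := fun i => nth [::] ws i.
have sz : input_size ws = k + m + e + size x + size r.
  by rewrite /input_size /ws /= !size_nseq; lia.
have sbig i : 4 < i -> s i = [::] by do 5 (case: i => [//|i]); rewrite /s /= nth_nil.
have sg : s \o g = s.
  apply/funext => i; rewrite /= /g; case: eqP => [->|_].
    by rewrite (sbig 5) // sbig.
  by case: eqP => [->|_] //; rewrite (sbig 5) // sbig.
pose s1 := upd s 6 (un (size x)).
pose f j := upd (upd s1 1 (un j)) 5 [seq F i | i <- iota j (m - j)].
have NE : N = k + m + e + size x + size r + 2 by rewrite /N sz.
have step1 : execb (While 3 nonblank (mvbit 3 8 ;; Push 6 true) ;; mvbits 8 3) s s1
   ((size x * 7 + 1) + (size x * 5 + 1)).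
  apply: execb_weak (execb_seq (execb_count (x := x) _ _ _) (execb_mvbits _ _)) _ _ => //.
  - rewrite /s1; st_eq; first by rewrite catrevE revK cats0.
  - by rewrite /upd /= size_rev.
have fm : f m = s1.
  by rewrite /f /s1; st_eq; rewrite ?subnn // sbig.
have step2 : execb (loop 1 (compile ex reg3 8 ;; Push 5 false ;;
    loop 8 (If 5 is_one (Pop 5 ;; Push 5 false) (Pop 5 ;; Push 5 true)))) s1 (f 0)
   (m * ((N ^ c + (2 + (N ^ c * 6 + 1))) + 2) + 1).
  rewrite -{1}fm; apply: execb_loop => [j hj|j hj]; first by rewrite /f; reg.
  set s2 := upd (f j.+1) 1 (un j).
  have lay : layout inp (env3 j e (size x)) reg3 8 s2.
    split => //.
    - by move=> v; split; case: v => [|[|[|v]]].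
    - by case.
    - by move=> i hi; rewrite /s2 /f /s1; reg; apply: sbig; lia.
  have envN v : env3 j e (size x) v <= N by case: v => [|[|[|v]]] /=; lia.
  have [vb eb] := G _ _ _ _ _ envN lay.
  apply: execb_weak (execb_seq eb (execb_seq (execb_push (erefl _)) (execb_parity (a :=
    expr_val inp ex (env3 j e (size x))) _))) _ _ => //.
  - rewrite /s2 /f; st_eq.
    + have -> : m - j = (m - j.+1).+1 by lia.
      by [].
  - by lia.
have [t tb ex1] := execb_seq step1 step2.
have f5 : (f 0 \o g) T = mkseq F m.
  rewrite /= /g; have -> : (T == 5) = false by apply/eqP; rewrite /T; lia.
  by rewrite eqxx /f subn0 /upd.
have := exec_rename gg ex1; rewrite sg => ex2.
rewrite -f5; apply: machine_outputs ex2 _.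
  apply: rename_below => [i|].
    by rewrite /g; case: eqP => // _; case: eqP => // _ _; rewrite /T.
  rewrite /= Hh ?andbT //; try by rewrite /T; lia.
  by case=> [|[|[|v]]].
apply: leq_trans tb _; 
have Nc : N <= N ^ c by rewrite -[X in X <= _]expn1 leq_pexp2l //; lia.
apply: (@leq_trans (N ^ (c * 8))).
  rewrite expnM; apply: leq_trans (quadratic_le_exp8 _); last by lia.
  have : m <= N ^ c by lia.
  have : size x <= N ^ c by lia.
  by have := leq_trans N2 Nc; nia.
have : N = input_size ws + 2 by []. move: N (input_size ws) N2 {NE G Nc step1 step2 sz}
  => N q N2 ->.
case: (posnP q) => [q0|q0].
  rewrite q0 /=; apply: leq_trans (leq_addl _ _).
  by apply: (@leq_trans (3 ^ (c * 8))); [case: (c * 8) => // z;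
    rewrite leq_exp2r | rewrite leq_pexp2l //; lia].
apply: leq_trans (leq_addr _ _).
apply: (@leq_trans ((3 * q) ^ (c * 8))).
  by case: (c * 8) => // z; rewrite leq_exp2r //; lia.
rewrite expnMn leq_mul // leq_pexp2l //; first by lia.
by have := @ltn_expl 3 (c * 8 + 8) isT; lia.
Qed.

(** * Deviation from uniform *)

Local Open Scope ring_scope.

Section TupleSums.
Variable R : realType.

Lemma sum_tuple_cat a b (F : seq bool -> R) :
  \sum_(w : (a + b).-tuple bool) F w =
  \sum_(u : a.-tuple bool) \sum_(v : b.-tuple bool) F (u ++ v).
Proof.
rewrite pair_big /=.
rewrite (reindex (fun p : a.-tuple bool * b.-tuple bool => cat_tuple p.1 p.2)) //=.
apply: onW_bij; apply: inj_card_bij => [[u v] [u' v'] /= /(congr1 val) /= /eqP|].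
  by rewrite eqseq_cat ?size_tuple // => /andP[/eqP/val_inj-> /eqP/val_inj->].
by rewrite card_prod !card_tuple card_bool expnD.
Qed.

Lemma sum_tuple0 (F : seq bool -> R) : \sum_(w : 0.-tuple bool) F w = F [::].
Proof.
rewrite (bigD1 [tuple]) //= big1 ?addr0 // => w.
by rewrite (tuple0 w) => /eqP.
Qed.

Lemma sum_tuple1 (F : seq bool -> R) :
  \sum_(w : 1.-tuple bool) F w = F [:: true] + F [:: false].
Proof.
rewrite (reindex (fun b : bool => [tuple b])) /=.
  by rewrite big_bool.
apply: onW_bij; apply: inj_card_bij => [b b' /(congr1 val) /= [] //|].
by rewrite card_tuple card_bool.
Qed.

Lemma sum_tuple_cons n (F : seq bool -> R) :
  \sum_(w : n.+1.-tuple bool) F w =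
  \sum_(u : n.-tuple bool) (F (true :: u) + F (false :: u)).
Proof.
rewrite -(add1n n) sum_tuple_cat.
rewrite (sum_tuple1 (fun u => \sum_(v : n.-tuple bool) F (u ++ v))).
by rewrite -big_split.
Qed.

Lemma sum_tuple_const n (c : R) : \sum_(w : n.-tuple bool) c = 2 ^+ n * c.
Proof. by rewrite sumr_const card_tuple card_bool -[_ *+ _]mulr_natl natrX. Qed.

Lemma sum_tuple_delta l (s : seq bool) (G : seq bool -> R) : size s = l ->
  \sum_(v : l.-tuple bool) G v * (s == v)%:R = G s.
Proof.
move=> sl; have sl' : size s == l by apply/eqP.
rewrite (bigD1 (Tuple sl')) //= eqxx mulr1 big1 ?addr0 // => v.
by rewrite -val_eqE /= eq_sym => /negbTE ->; rewrite mulr0.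
Qed.

Definition avg n (F : seq bool -> R) : R :=
  (2 ^+ n)^-1 * \sum_(w : n.-tuple bool) F w.

Lemma pow2_gt0 n : 0 < 2 ^+ n :> R. Proof. by rewrite exprn_gt0. Qed.
Lemma pow2_neq0 n : 2 ^+ n != 0 :> R. Proof. by rewrite gt_eqF ?pow2_gt0. Qed.
Lemma pow2V_ge0 n : 0 <= (2 ^+ n)^-1 :> R.
Proof. by rewrite invr_ge0 ltW ?pow2_gt0. Qed.

Lemma avg_cat a b F : avg (a + b) F = avg a (fun u => avg b (fun v => F (u ++ v))).
Proof. by rewrite /avg sum_tuple_cat -mulr_sumr mulrA exprD invfM. Qed.

Lemma avg_const n c : avg n (fun=> c) = c.
Proof. by rewrite /avg sum_tuple_const mulKf ?pow2_neq0. Qed.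

Lemma eq_avg n F G : (forall w, size w = n -> F w = G w) -> avg n F = avg n G.
Proof. by move=> h; congr (_ * _); apply: eq_bigr => w _; rewrite h ?size_tuple. Qed.

Lemma le_avg n F G : (forall w, size w = n -> F w <= G w) -> avg n F <= avg n G.
Proof.
move=> h; apply: ler_wpM2l; first exact: pow2V_ge0.
by apply: ler_sum => w _; rewrite h ?size_tuple.
Qed.

Lemma avgD n F G : avg n (fun w => F w + G w) = avg n F + avg n G.
Proof. by rewrite /avg big_split mulrDr. Qed.

Lemma avgZ n c F : avg n (fun w => c * F w) = c * avg n F.
Proof. by rewrite /avg -mulr_sumr mulrCA. Qed.

Lemma avg_sum n (I : finType) (F : I -> seq bool -> R) :
  avg n (fun w => \sum_i F i w) = \sum_i avg n (F i).
Proof. by rewrite /avg exchange_big mulr_sumr. Qed.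

Lemma avgC n m F : avg n (fun u => avg m (fun v => F u v)) =
  avg m (fun v => avg n (fun u => F u v)).
Proof.
rewrite /avg -2!mulr_sumr exchange_big /= mulrCA.
by [].
Qed.

End TupleSums.

Section Deviation.
Variables (R : realType) (X : finType).
Implicit Types (P : X -> R) (f : X -> seq bool).

Definition mass P : R := \sum_x P x.
Definition nonneg P := forall x, 0 <= P x.

(* For a subprobability P this is the l1 distance between the law of f and the
   uniform law on m bits, scaled to the total mass of P. *)
Definition dev m P f : R :=
  \sum_(z : m.-tuple bool)
    `|\sum_x P x * (f x == z)%:R - (2 ^+ m)^-1 * mass P|.

Definition restrict P (c : X -> seq bool) (v : seq bool) : X -> R :=
  fun x => P x * (c x == v)%:R.

Lemma mass_ge0 P : nonneg P -> 0 <= mass P.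
Proof. by move=> h; apply: sumr_ge0 => x _. Qed.

Lemma nonneg_restrict P c v : nonneg P -> nonneg (restrict P c v).
Proof. by move=> h x; rewrite mulr_ge0. Qed.

Lemma restrict_le P c v x : nonneg P -> restrict P c v x <= P x.
Proof. by move=> h; rewrite /restrict; case: eqP; rewrite ?mulr1 ?mulr0. Qed.

Lemma mass_restrict l P c : (forall x, size (c x) = l) ->
  \sum_(v : l.-tuple bool) mass (restrict P c v) = mass P.
Proof.
move=> h; rewrite /mass exchange_big; apply: eq_bigr => x _ /=.
exact: (sum_tuple_delta (fun=> P x) (h x)).
Qed.

Lemma eq_dev m P P' f f' : P =1 P' -> f =1 f' -> dev m P f = dev m P' f'.
Proof.
move=> hP hf; apply: eq_bigr => z _; congr (`|_ - _ * _|).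
  by apply: eq_bigr => x _; rewrite hP hf.
by apply: eq_bigr => x _.
Qed.

Lemma dev_add m P P' f : dev m (fun x => P x + P' x) f <= dev m P f + dev m P' f.
Proof.
rewrite -big_split; apply: ler_sum => z _ /=.
apply: le_trans (ler_normD _ _); rewrite le_eqVlt; apply/orP; left; apply/eqP.
congr `|_|; rewrite /mass big_split mulrDr /=.
under eq_bigr do rewrite mulrDl.
by rewrite big_split /=; ring.
Qed.

Lemma dev_le_mass m P f : nonneg P -> (forall x, size (f x) = m) ->
  dev m P f <= 2 * mass P.
Proof.
move=> hP hf.
apply: (@le_trans _ _ (\sum_(z : m.-tuple bool)
   (\sum_x P x * (f x == z)%:R + (2 ^+ m)^-1 * mass P))).
  apply: ler_sum => z _; apply: le_trans (ler_normB _ _) _.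
  rewrite !ger0_norm //; first by rewrite mulr_ge0 ?pow2V_ge0 ?mass_ge0.
  by apply: sumr_ge0 => x _; rewrite mulr_ge0.
rewrite big_split sum_tuple_const /= mulVKf ?pow2_neq0 //.
rewrite -/(\sum_(z : m.-tuple bool) mass (restrict P f z)).
by rewrite (mass_restrict P hf); lra.
Qed.

Lemma dev_mass0 m P f : nonneg P -> mass P = 0 -> dev m P f = 0.
Proof.
move=> hP h0; have P0 x : P x = 0.
  by apply: (psumr_eq0P _ h0) => // y _; apply: hP.
rewrite /dev big1 // => z _; rewrite h0 mulr0 subr0 big1 ?normr0 // => x _.
by rewrite P0 mul0r.
Qed.

(** A hybrid argument through [phi (c x)] followed by uniform bits. Conditioning is on [c], which
    may be finer than the first string, so that the restricted source need not depend on [phi]. *)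
Lemma dev_cat m1 m2 l P (c : X -> seq bool) (phi : seq bool -> seq bool)
    (f : X -> seq bool) :
  (forall x, size (c x) = l) -> (forall x, size (phi (c x)) = m1) ->
  dev (m1 + m2) P (fun x => phi (c x) ++ f x) <=
  dev m1 P (fun x => phi (c x)) +
  \sum_(v : l.-tuple bool) dev m2 (restrict P c v) f.
Proof.
move=> hc hphi.
pose D (v z : seq bool) := \sum_x restrict P c v x * (f x == z)%:R
  - (2 ^+ m2)^-1 * mass (restrict P c v).
pose A (z1 z2 : seq bool) := \sum_x P x * (phi (c x) == z1)%:R * (f x == z2)%:R.
pose A1 (z : seq bool) := \sum_x P x * (phi (c x) == z)%:R.
have split_c (h : X -> R) (z1 : seq bool) : \sum_x P x * (phi (c x) == z1)%:R * h x =
    \sum_(v : l.-tuple bool | phi v == z1) \sum_x restrict P c v x * h x.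
  rewrite [RHS]big_mkcond /=.
  transitivity (\sum_(v : l.-tuple bool)
      \sum_x P x * h x * ((phi v == z1)%:R * (c x == v)%:R)); last first.
    apply: eq_bigr => v _; case: eqP => _; last first.
      by rewrite big1 // => x _; rewrite mul0r mulr0.
    by apply: eq_bigr => x _; rewrite /restrict mul1r; ring.
  rewrite exchange_big; apply: eq_bigr => x _ /=; rewrite -mulr_sumr.
  by rewrite (sum_tuple_delta (fun v => (phi v == z1)%:R) (hc x)); ring.
have AE (z1 z2 : seq bool) : A z1 z2 - (2 ^+ m2)^-1 * A1 z1 =
    \sum_(v : l.-tuple bool | phi v == z1) D v z2.
  rewrite sumrB -mulr_sumr /A split_c; congr (_ - _ * _).
  have -> : A1 z1 = \sum_x P x * (phi (c x) == z1)%:R * 1.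
    by apply: eq_bigr => x _; rewrite mulr1.
  rewrite (split_c (fun=> 1)); apply: eq_bigr => v _; apply: eq_bigr => x _.
  exact: mulr1.
rewrite {1}/dev.
rewrite (sum_tuple_cat m1 m2 (fun z => `|\sum_x P x * (phi (c x) ++ f x == z)%:R
   - (2 ^+ (m1 + m2))^-1 * mass P|)).
apply: (@le_trans _ _ (\sum_(z1 : m1.-tuple bool) \sum_(z2 : m2.-tuple bool)
  ((2 ^+ m2)^-1 * `|A1 z1 - (2 ^+ m1)^-1 * mass P| +
   \sum_(v : l.-tuple bool | phi v == z1) `|D v z2|))).
  apply: ler_sum => z1 _; apply: ler_sum => z2 _.
  have -> : \sum_x P x * (phi (c x) ++ f x == z1 ++ z2)%:R = A z1 z2.
    apply: eq_bigr => x _; rewrite eqseq_cat ?hphi ?size_tuple //.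
    by rewrite -mulrA -natrM mulnb.
  have -> : A z1 z2 - (2 ^+ (m1 + m2))^-1 * mass P =
      (2 ^+ m2)^-1 * (A1 z1 - (2 ^+ m1)^-1 * mass P) +
      (A z1 z2 - (2 ^+ m2)^-1 * A1 z1) by rewrite exprD invfM; ring.
  apply: le_trans (ler_normD _ _) _; apply: lerD.
    by rewrite normrM ger0_norm ?pow2V_ge0.
  by rewrite AE; apply: ler_norm_sum.
under eq_bigr do rewrite big_split /= sum_tuple_const mulVKf ?pow2_neq0 //.
rewrite big_split lerD //=.
under eq_bigr do rewrite exchange_big big_mkcond /=.
rewrite exchange_big; apply: ler_sum => v _ /=.
(* A value [v] is counted for at most one prefix, namely [phi v]. *)
rewrite -big_mkcond /= sumr_const.
rewrite -[X in _ <= X]mulr1n ler_wpMn2l //; first by apply: sumr_ge0.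
apply/card_le1_eqP => z z'; rewrite !unfold_in => /eqP hz /eqP hz'.
by apply: val_inj; rewrite /= -hz -hz'.
Qed.

End Deviation.

(** * Hashing *)

Fixpoint ip (u v : seq bool) : bool :=
  match u, v with a :: u', b :: v' => (a && b) (+) ip u' v' | _, _ => false end.

Fixpoint hash (m l : nat) (sh y : seq bool) : seq bool :=
  if m is m'.+1 then ip (take l sh) y :: hash m' l (drop l sh) y else [::].

Lemma size_hash m l sh y : size (hash m l sh y) = m.
Proof. by elim: m sh => //= m IH sh; rewrite IH. Qed.

Section Hash.
Variable R : realType.

Lemma sum_sign_ip l (y y' : seq bool) : size y = l -> size y' = l -> y != y' ->
  \sum_(u : l.-tuple bool) (-1) ^+ (ip u y (+) ip u y') = 0 :> R.
Proof.
elim: l y y' => [|l IH] [|a y] [|b y'] //= [sy] [sy'] ne.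
rewrite (sum_tuple_cons l (fun u => (-1) ^+ (ip u (a :: y) (+) ip u (b :: y')))) /=.
case: (eqVneq y y') ne => [<-|ne _].
  rewrite eqseq_cons eqxx andbT => ab; rewrite big1 // => u _.
  by rewrite !addbA; case: a b ab (ip u y) => [] [] //= _ []; rewrite /= ?expr0 ?expr1;
    ring.
transitivity (((-1) ^+ (a (+) b) + 1) *
    \sum_(u : l.-tuple bool) (-1) ^+ (ip u y (+) ip u y') : R); last by rewrite IH ?mulr0.
rewrite mulr_sumr.
apply: eq_bigr => u _.
by case: a; case: b; case: (ip u y); case: (ip u y'); rewrite /= ?expr0 ?expr1; ring.
Qed.

Lemma avg_ip_eq l (y y' : seq bool) : size y = l -> size y' = l -> y != y' ->
  avg l (fun u => (ip u y == ip u y')%:R) = 2^-1 :> R.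
Proof.
move=> sy sy' ne.
rewrite (@eq_avg _ _ _ (fun u => 2^-1 + 2^-1 * (-1) ^+ (ip u y (+) ip u y'))).
  rewrite avgD avg_const avgZ /avg sum_sign_ip //; ring.
by move=> u _; case: (ip u y); case: (ip u y'); rewrite /= ?expr0 ?expr1; field.
Qed.

Lemma avg_hash_eq m l (y y' : seq bool) : size y = l -> size y' = l -> y != y' ->
  avg (m * l) (fun sh => (hash m l sh y == hash m l sh y')%:R) = (2 ^+ m)^-1 :> R.
Proof.
move=> sy sy' ne; elim: m => [|m IH].
  by rewrite mul0n /= avg_const expr0 invr1.
rewrite mulSn avg_cat.
rewrite (@eq_avg _ _ _ (fun u => (2 ^+ m)^-1 * (ip u y == ip u y')%:R)).
  by rewrite avgZ avg_ip_eq // exprS invfM mulrC.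
move=> u su; rewrite -IH mulrC -avgZ; apply: eq_avg => v _.
by rewrite /= !take_size_cat ?drop_size_cat // eqseq_cons -mulnb natrM.
Qed.

Variable X : finType.

(* The leftover hash lemma, with the Cauchy-Schwarz step replaced by the pointwise
   bound |w| <= a w^2 + 1/a for the constant a = 2^m/tau. *)
Lemma hash_dev m l (P : X -> R) (y : X -> seq bool) (beta tau : R) :
  nonneg P -> (forall x, size (y x) = l) -> 0 < tau ->
  (forall v, mass (restrict P y v) <= beta) ->
  avg (m * l) (fun sh => dev m P (fun x => hash m l sh (y x))) <=
  2 ^+ m * beta * mass P / tau + tau.
Proof.
move=> hP hy tau0 hb.
set M := mass P.
pose A sh (z : seq bool) := \sum_x P x * (hash m l sh (y x) == z)%:R.
pose coll sh := \sum_x \sum_x' P x * P x' * (hash m l sh (y x) == hash m l sh (y x'))%:R.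
have pw (w a : R) : 0 < a -> `|w| <= a * w ^+ 2 + a^-1.
  move=> a0; rewrite -(real_normK (num_real w)); move: `|w| (normr_ge0 w) => {w} w w0.
  have h : 0 <= a * (w - a^-1) ^+ 2 by rewrite mulr_ge0 ?sqr_ge0 ?ltW.
  have E : a * (w - a^-1) ^+ 2 = a * w ^+ 2 - 2 * w + a^-1 by field; rewrite gt_eqF.
  by rewrite E in h; lra.
have sq sh : \sum_(z : m.-tuple bool) (A sh z - (2 ^+ m)^-1 * M) ^+ 2 =
    coll sh - (2 ^+ m)^-1 * M ^+ 2.
  have sA : \sum_(z : m.-tuple bool) A sh z = M.
    by apply: mass_restrict => x; rewrite size_hash.
  have sA2 : \sum_(z : m.-tuple bool) A sh z ^+ 2 = coll sh.
    transitivity (\sum_(z : m.-tuple bool) \sum_x \sum_x' P x * P x' *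
      (hash m l sh (y x) == z)%:R * (hash m l sh (y x') == z)%:R).
      apply: eq_bigr => z _; rewrite expr2 /A mulr_suml; apply: eq_bigr => x _.
      by rewrite mulr_sumr; apply: eq_bigr => x' _; ring.
    rewrite exchange_big; apply: eq_bigr => x _ /=.
    rewrite exchange_big; apply: eq_bigr => x' _ /=.
    rewrite (sum_tuple_delta (fun z => P x * P x' * (hash m l sh (y x) == z)%:R)) //.
    by rewrite size_hash.
  set c := (2 ^+ m)^-1 * M.
  transitivity (\sum_(z : m.-tuple bool) (A sh z ^+ 2 + (- (2 * c)) * A sh z + c ^+ 2)).
    by apply: eq_bigr => z _; ring.
  rewrite !big_split /= -mulr_sumr sA sA2 sum_tuple_const /c.
  by field; rewrite pow2_neq0.
(* Pairs with equal [y] weigh at most [beta * M], since each fibre of [y] has mass at most [beta];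
   any other pair collides with probability exactly 2^-m, and that part later cancels against the
   square of the mean. *)
have collE : avg (m * l) coll <= beta * M + (2 ^+ m)^-1 * M ^+ 2.
  rewrite avg_sum.
  apply: (@le_trans _ _ (\sum_x (P x * beta + (2 ^+ m)^-1 * P x * M))); last first.
    rewrite big_split /= -!mulr_suml -mulr_sumr -/(mass P) -/M.
    by rewrite le_eqVlt; apply/orP; left; apply/eqP; ring.
  apply: ler_sum => x _; rewrite avg_sum.
  apply: (@le_trans _ _ (\sum_x' (P x * restrict P y (y x) x' + (2 ^+ m)^-1 * P x * P x'))).
    apply: ler_sum => x' _; rewrite avgZ /restrict.
    have PP : 0 <= P x * P x' by rewrite mulr_ge0.
    have -> : P x * (P x' * (y x' == y x)%:R) + (2 ^+ m)^-1 * P x * P x' =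
       P x * P x' * ((y x' == y x)%:R + (2 ^+ m)^-1) by ring.
    apply: ler_wpM2l => //; rewrite [y x' == _]eq_sym.
    case: eqVneq => [->|ne]; last by rewrite avg_hash_eq // add0r.
    rewrite (@eq_avg _ _ _ (fun=> 1)) ?avg_const; last by move=> w _; rewrite eqxx.
    by rewrite lerDl pow2V_ge0.
  rewrite big_split /= -!mulr_sumr; apply: lerD => //.
  by apply: ler_wpM2l; [exact: hP | exact: hb].
have a0 : 0 < 2 ^+ m / tau by rewrite divr_gt0 ?pow2_gt0.
apply: (@le_trans _ _ (avg (m * l) (fun sh => 2 ^+ m / tau * coll sh +
   (tau - M ^+ 2 / tau)))).
  apply: le_avg => sh _.
  apply: (@le_trans _ _ (\sum_(z : m.-tuple bool)
    (2 ^+ m / tau * (A sh z - (2 ^+ m)^-1 * M) ^+ 2 + (2 ^+ m / tau)^-1))).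
    by apply: ler_sum => z _; apply: pw.
  rewrite big_split /= -mulr_sumr sq sum_tuple_const le_eqVlt; apply/orP; left; apply/eqP.
  by field; rewrite pow2_neq0 gt_eqF.
rewrite avgD avgZ avg_const.
have h := ler_wpM2l (ltW a0) collE.
apply: le_trans (lerD h (lexx _)) _.
rewrite le_eqVlt; apply/orP; left; apply/eqP.
by field; rewrite pow2_neq0 gt_eqF.
Qed.

End Hash.

(** * Sampling cells from a source *)

Definition pre (B i : nat) (y : seq bool) := take (i * B) y.
Definition cell (B i : nat) (y : seq bool) := take B (drop (i * B) y).

Lemma size_cell B i N y : size y = (N * B)%N -> (i < N)%N -> size (cell B i y) = B.
Proof. by move=> sy iN; rewrite size_take size_drop sy; case: ltnP => //; nia. Qed.

Lemma pre_cell B i y : pre B i y ++ cell B i y = pre B i.+1 y.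
Proof. by rewrite /pre /cell mulSn addnC takeD. Qed.

Section Chain.
Variables (R : realType) (B : nat).

(** Summing out the last cell first: the weights form a chain of subprobability kernels. *)
Lemma chain_sum N (w : nat -> seq bool -> seq bool -> R) :
  (forall i u c, 0 <= w i u c) ->
  (forall i u, (i < N)%N -> size u = (i * B)%N ->
     \sum_(c : B.-tuple bool) w i u c <= 1) ->
  \sum_(y : (N * B).-tuple bool) \prod_(i < N) w i (pre B i y) (cell B i y) <= 1.
Proof.
move=> w0; elim: N => [|N IH] H.
  rewrite mul0n (sum_tuple0 (fun y => \prod_(i < 0) w i (pre B i y) (cell B i y))).
  by rewrite big_ord0.
rewrite mulSnr (sum_tuple_cat (N * B) B
  (fun y => \prod_(i < N.+1) w i (pre B i y) (cell B i y))).
apply: le_trans (IH _); last by move=> i u iN; apply: H; lia.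
apply: ler_sum => u _.
rewrite -[X in _ <= X]mulr1.
apply: (@le_trans _ _ (\prod_(i < N) w i (pre B i u) (cell B i u) *
    \sum_(c : B.-tuple bool) w N u c)); last first.
  by apply: ler_wpM2l; [apply: prodr_ge0 | apply: H; rewrite ?size_tuple].
rewrite mulr_sumr; apply: ler_sum => v _.
rewrite big_ord_recr /= le_eqVlt; apply/orP; left; apply/eqP.
congr (_ * w N _ _).
- apply: eq_bigr => i _; have iN := ltn_ord i.
  congr (w _ _ _); first by rewrite /pre takel_cat // size_tuple; nia.
  rewrite /cell drop_cat size_tuple; case: ltnP => h.
    by rewrite takel_cat // size_drop size_tuple -mulnBl leq_pmull // subn_gt0.
  (* Both cases of the split concern earlier cells; this one arises only when cells are empty. *)
  have B0 : B = 0%N by nia.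
  have t0 s : take B s = [::] :> seq bool by rewrite B0 take0.
  by rewrite !t0.
- by rewrite /pre take_size_cat ?size_tuple.
- by rewrite /cell drop_size_cat ?size_tuple // take_oversize // size_tuple.
Qed.

End Chain.

Section Source.
Variables (R : realType) (X : finType) (B N : nat).
Variables (T : X -> seq bool) (P : X -> R).
Hypothesis size_T : forall x, size (T x) = (N * B)%N.
Hypothesis inj_T : injective T.
Hypothesis P_ge0 : nonneg P.

Definition pmass (u : seq bool) : R := \sum_x P x * (take (size u) (T x) == u)%:R.
Definition cond (u c : seq bool) : R := pmass (u ++ c) / pmass u.

(* Mixing with the uniform law keeps the weights away from 0. *)
Definition mix (u c : seq bool) : R := cond u c / 2 + (2 ^+ B.+1)^-1.
Definition mixw (i : nat) (x : X) : R := mix (pre B i (T x)) (cell B i (T x)).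

Lemma pmass_ge0 u : 0 <= pmass u.
Proof. by apply: sumr_ge0 => x _; rewrite mulr_ge0. Qed.

Lemma cond_ge0 u c : 0 <= cond u c.
Proof. by rewrite divr_ge0 ?pmass_ge0. Qed.

Lemma pmass_cat_le u c : pmass (u ++ c) <= pmass u.
Proof.
apply: ler_sum => x _; apply: ler_wpM2l => //; rewrite ler_nat.
case: (eqVneq (take (size (u ++ c)) (T x)) (u ++ c)) => [E|//].
suff -> : take (size u) (T x) == u by [].
have := congr1 (take (size u)) E; rewrite take_size_cat // take_takel.
  by move=> ->.
by rewrite size_cat leq_addr.
Qed.

Lemma cond_le1 u c : cond u c <= 1.
Proof.
rewrite /cond; have := pmass_ge0 u; rewrite le_eqVlt => /orP[/eqP<-|h].
  by rewrite invr0 mulr0.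
by rewrite ler_pdivrMr // mul1r pmass_cat_le.
Qed.

Lemma sum_pmass_cat i u : (i < N)%N -> size u = (i * B)%N ->
  \sum_(c : B.-tuple bool) pmass (u ++ c) = pmass u.
Proof.
move=> iN su; rewrite /pmass exchange_big; apply: eq_bigr => x _ /=.
rewrite -mulr_sumr; congr (_ * _).
rewrite -(sum_tuple_delta (l := B) (s := cell B i (T x))
   (fun=> (take (size u) (T x) == u)%:R)); last exact: size_cell (size_T x) iN.
apply: eq_bigr => c _.
rewrite size_cat size_tuple takeD eqseq_cat; last first.
  by rewrite size_take size_T su; case: ltnP => //; nia.
by rewrite -mulnb natrM su.
Qed.

Lemma sum_cond i u : (i < N)%N -> size u = (i * B)%N ->
  \sum_(c : B.-tuple bool) cond u c <= 1.
Proof.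
move=> iN su; rewrite -mulr_suml (sum_pmass_cat iN su).
have [->|h] := eqVneq (pmass u) 0; first by rewrite mul0r.
by rewrite divff.
Qed.

Lemma mix_ge u c : (2 ^+ B.+1)^-1 <= mix u c.
Proof. by rewrite lerDr divr_ge0 ?cond_ge0. Qed.

Lemma mix_gt0 u c : 0 < mix u c.
Proof. by apply: lt_le_trans (mix_ge u c); rewrite invr_gt0 pow2_gt0. Qed.

Lemma mix_le1 u c : mix u c <= 1.
Proof.
have h : (2 ^+ B.+1)^-1 <= 2^-1 :> R.
  by rewrite exprS invfM ler_piMr // invf_le1 ?pow2_gt0 // exprn_ege1 // ler1n.
by have := cond_le1 u c; rewrite /mix; lra.
Qed.

Lemma cond_le_mix u c : cond u c <= 2 * mix u c.
Proof. by have := pow2V_ge0 R B.+1; rewrite /mix; lra. Qed.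

Lemma sum_mix i u : (i < N)%N -> size u = (i * B)%N ->
  \sum_(c : B.-tuple bool) mix u c <= 1.
Proof.
move=> iN su; rewrite big_split /= -mulr_suml sum_tuple_const.
have -> : 2 ^+ B * (2 ^+ B.+1)^-1 = 2^-1 :> R.
  by rewrite exprS invfM mulrCA divff ?mulr1 ?pow2_neq0.
by have := sum_cond iN su; lra.
Qed.

(** The product telescopes to the mass of the points that agree with [x] on all cells. If P x > 0,
    no denominator vanishes along the way. *)
Lemma source_le_cond x :
  P x <= mass P * \prod_(i < N) cond (pre B i (T x)) (cell B i (T x)).
Proof.
have [P0|P0] := eqVneq (P x) 0.
  rewrite P0; apply: mulr_ge0; first exact: mass_ge0.
  by apply: prodr_ge0 => i _; apply: cond_ge0.
have pm n : P x <= pmass (pre B n (T x)).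
  rewrite /pmass (bigD1 x) //= -[X in X <= _]addr0; apply: lerD; last first.
    by apply: sumr_ge0 => y _; rewrite mulr_ge0.
  rewrite /pre; have -> : take (size (take (n * B) (T x))) (T x) = take (n * B) (T x).
    rewrite size_take; case: ltnP => // h; rewrite take_size take_oversize //.
  by rewrite eqxx mulr1.
have pm0 n : 0 < pmass (pre B n (T x)).
  by apply: lt_le_trans (pm n); rewrite lt_neqAle eq_sym P0 P_ge0.
have tele n : mass P * \prod_(i < n) cond (pre B i (T x)) (cell B i (T x)) =
    pmass (pre B n (T x)).
  elim: n => [|n IH].
    rewrite big_ord0 mulr1 /pre mul0n take0 /pmass; apply: eq_bigr => y _.
    by rewrite take0 eqxx mulr1.
  rewrite big_ord_recr /= mulrA IH /cond pre_cell mulrCA divff ?mulr1 //.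
  by rewrite gt_eqF.
by rewrite tele pm.
Qed.

Lemma sum_inj_le (F : seq bool -> R) : (forall y, 0 <= F y) ->
  \sum_x F (T x) <= \sum_(y : (N * B).-tuple bool) F y.
Proof.
move=> F0.
apply: (@le_trans _ _ (\sum_x \sum_(y : (N * B).-tuple bool) F y * (T x == y)%:R)).
  rewrite le_eqVlt; apply/orP; left; apply/eqP.
  by apply: eq_bigr => x _; rewrite (sum_tuple_delta F).
rewrite exchange_big; apply: ler_sum => y _; rewrite -mulr_sumr /=.
rewrite -[X in _ <= X]mulr1; apply: ler_wpM2l => //.
rewrite -natr_sum -[1]/(1%:R) ler_nat -big_mkcond /= sum1_card.
apply/card_le1_eqP => x x'; rewrite !unfold_in => /eqP E /eqP E'.
by apply: inj_T; rewrite E E'.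
Qed.

(** The only place where the pointwise bound on P is used. Where the product exceeds [rho], P x <=
    theta <= (theta / rho) times the product, and the product is a subprobability on all strings. *)
Lemma heavy_mass (theta rho : R) : 0 <= theta -> (forall x, P x <= theta) -> 0 < rho ->
  \sum_x P x * (rho < \prod_(i < N) mixw i x)%R%:R <= theta / rho.
Proof.
move=> th0 hth rho0.
pose F y : R := \prod_(i < N) mix (pre B i y) (cell B i y).
have F0 y : 0 <= F y by apply: prodr_ge0 => i _; apply/ltW/mix_gt0.
apply: (@le_trans _ _ (theta / rho * \sum_x F (T x))).
  rewrite mulr_sumr; apply: ler_sum => x _; rewrite -/(F (T x)).
  have h : 0 <= theta / rho by exact: divr_ge0 th0 (ltW rho0).
  case: ltP => [lt|_]; last by rewrite mulr0 mulr_ge0.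
  rewrite mulr1 -mulrA [rho^-1 * _]mulrC mulrA ler_pdivlMr //.
  by apply: ler_pM; [exact: P_ge0 | exact: ltW | exact: hth | exact: ltW].
rewrite -[X in _ <= X]mulr1; apply: ler_wpM2l; first exact: divr_ge0 th0 (ltW rho0).
apply: le_trans (sum_inj_le F0) _.
apply: (@chain_sum R B N (fun _ => mix)) => [_ u c|i u]; first exact/ltW/mix_gt0.
exact: sum_mix.
Qed.

End Source.

Definition samp (l0 G B : nat) (sel : nat -> nat) (y : seq bool) : seq bool :=
  mkseq (fun c => nth false y ((c %/ B * G + sel (c %/ B)%N) * B + c %% B)) (l0 * B).

Lemma size_samp l0 G B sel y : size (samp l0 G B sel y) = (l0 * B)%N.
Proof. by rewrite size_mkseq. Qed.

Lemma cell_samp l0 G B sel y j : size y = (l0 * G * B)%N -> (j < l0)%N ->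
  (sel j < G)%N ->
  cell B j (samp l0 G B sel y) = cell B (j * G + sel j) y.
Proof.
move=> sy jl sG.
have iN : (j * G + sel j < l0 * G)%N by nia.
apply: (@eq_from_nth _ false).
  by rewrite (size_cell (size_samp l0 G B sel y)) // (size_cell sy).
rewrite (size_cell (size_samp l0 G B sel y)) // => b bB.
rewrite /cell !nth_take // !nth_drop nth_mkseq; last by nia.
by rewrite divnMDl ?modnMDl ?divn_small ?modn_small ?addn0 //; lia.
Qed.

Lemma prod_ord_mul (R : realType) l G (F : nat -> R) :
  \prod_(i < l * G) F i = \prod_(j < l) \prod_(v < G) F (j * G + v)%N.
Proof.
rewrite -(big_mkord xpredT F) big_nat_mul big_mkord; apply: eq_bigr => j _.
rewrite -{1}[(j * G)%N]add0n big_addn mulSn addnK big_mkord.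
by apply: eq_bigr => v _; rewrite addnC.
Qed.

Section GoodMass.
Variables (R : realType) (X : finType) (B l0 G : nat).
Variables (T : X -> seq bool) (P : X -> R).
Hypothesis size_T : forall x, size (T x) = (l0 * G * B)%N.
Hypothesis inj_T : injective T.
Hypothesis P_ge0 : nonneg P.
Variable sel : nat -> nat.
Hypothesis sel_lt : forall j, (sel j < G)%N.

Notation q := (mixw B T P).

(* Replacing the conditional probability of each sampled cell by the indicator of
   its prescribed value leaves a chain of subprobabilities. *)
Lemma light_sample_mass (rho : R) (v : seq bool) : 0 <= rho ->
  \sum_x P x * (\prod_(j < l0) q (j * G + sel j)%N x <= rho)%R%:R *
    (samp l0 G B sel (T x) == v)%:R <= mass P * 2 ^+ l0 * rho.
Proof.
move=> rho0.
pose C i x := cond T P (pre B i (T x)) (cell B i (T x)).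
pose w (i : nat) (u c : seq bool) : R :=
  if (i %% G == sel (i %/ G))%N then (c == cell B (i %/ G) v)%:R else cond T P u c.
have w0 i u c : 0 <= w i u c by rewrite /w; case: ifP => // _; apply: cond_ge0.
pose W (y : seq bool) := \prod_(i < l0 * G) w i (pre B i y) (cell B i y).
have W0 y : 0 <= W y by apply: prodr_ge0.
have WE x : W (T x) = \prod_(j < l0) ((cell B (j * G + sel j) (T x) == cell B j v)%:R
    * \prod_(u < G | u != Ordinal (sel_lt j)) C (j * G + u)%N x).
  rewrite /W (prod_ord_mul l0 G (fun i => w i (pre B i (T x)) (cell B i (T x)))).
  apply: eq_bigr => j _; rewrite (bigD1 (Ordinal (sel_lt j))) //=.
  have dm (u : 'I_G) : ((j * G + u) %/ G = j)%N /\ ((j * G + u) %% G = u)%N.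
    have Gp : (0 < G)%N by apply: leq_ltn_trans (ltn_ord u).
    by rewrite divnMDl // modnMDl divn_small // modn_small // addn0.
  congr (_ * _).
    by have [/= e1 e2] := dm (Ordinal (sel_lt j)); rewrite /w e1 e2 eqxx.
  apply: eq_bigr => u hu; have [e1 e2] := dm u; rewrite /w e1 e2.
  by rewrite -val_eqE /= in hu; rewrite (negbTE hu).
have PE x : P x <= mass P * \prod_(j < l0) (C (j * G + sel j)%N x *
    \prod_(u < G | u != Ordinal (sel_lt j)) C (j * G + u)%N x).
  apply: le_trans (@source_le_cond R X B (l0 * G) T P P_ge0 x) _.
  rewrite (prod_ord_mul l0 G (fun i => C i x)) le_eqVlt; apply/orP; left; apply/eqP.
  by congr (_ * _); apply: eq_bigr => j _; rewrite (bigD1 (Ordinal (sel_lt j))).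
have C0 i x : 0 <= C i x by apply: cond_ge0.
have M0 : 0 <= mass P by apply: mass_ge0.
have K0 : 0 <= mass P * 2 ^+ l0 * rho.
  by apply: mulr_ge0 => //; apply: mulr_ge0 => //; apply: exprn_ge0.
apply: (@le_trans _ _ (mass P * 2 ^+ l0 * rho * \sum_x W (T x))); last first.
  rewrite -[X in _ <= X]mulr1; apply: ler_wpM2l => //.
  apply: le_trans (sum_inj_le size_T inj_T W0) _.
  apply: (@chain_sum R B (l0 * G) w) => // i u il su; rewrite /w;
    case: (i %% G == sel (i %/ G))%N.
    (* If [v] is too short its cell has fewer than B bits, and the indicator is identically 0. *)
    have [e|ne] := eqVneq (size (cell B (i %/ G) v)) B.
      rewrite (eq_bigr (fun c : B.-tuple bool => 1 * (cell B (i %/ G) v == c)%:R)).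
        by rewrite (sum_tuple_delta (fun=> 1)).
      by move=> c _; rewrite mul1r eq_sym.
    rewrite big1 // => c _; case: eqP => // E.
    by rewrite -E size_tuple eqxx in ne.
  exact: (sum_cond P size_T il su).
rewrite mulr_sumr; apply: ler_sum => x _.
case: (eqVneq (samp l0 G B sel (T x)) v) => [sv|_]; last by rewrite mulr0 mulr_ge0.
rewrite mulr1; case: (leP _ rho) => [le|_]; last by rewrite mulr0 mulr_ge0.
rewrite mulr1.
have -> : W (T x) = \prod_(j < l0) \prod_(u < G | u != Ordinal (sel_lt j)) C (j * G +
  u)%N x.
  rewrite WE; apply: eq_bigr => j _.
  by rewrite -sv cell_samp // eqxx mul1r.
apply: le_trans (PE x) _.
rewrite -2!mulrA; apply: ler_wpM2l => //.
rewrite big_split mulrA /=; apply: ler_wpM2r.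
  by apply: prodr_ge0 => j _; apply: prodr_ge0.
(* Passing from conditional to mixed weights costs a factor 2 per sampled cell, hence the 2^l0. *)
apply: (@le_trans _ _ (\prod_(j < l0) (2 * q (j * G + sel j)%N x))).
  by apply: ler_prod => j _; rewrite C0 cond_le_mix.
rewrite big_split /= prodr_const card_ord; apply: ler_wpM2l; first exact: exprn_ge0.
exact: le.
Qed.

End GoodMass.

(** * Concentration over the random selection *)

Definition pidx (g : nat) (s : seq bool) : nat := \sum_(u < g) nth false s u * 2 ^ u.

Lemma pidx_lt g s : (pidx g s < 2 ^ g)%N.
Proof.
rewrite /pidx; elim: g => [|g IH]; first by rewrite big_ord0.
rewrite big_ord_recr /= expnS mul2n -addnn -addSn leq_add //.
by case: nth; rewrite ?mul1n ?mul0n.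
Qed.

Definition sel_of (g : nat) (sp : seq bool) (j : nat) : nat := pidx g (drop (j * g) sp).

Section Concentration.
Variable R : realType.

Lemma avg_pidx g (f : nat -> R) :
  avg g (fun w => f (pidx g w)) = (2 ^+ g)^-1 * \sum_(v < 2 ^ g) f v.
Proof.
congr (_ * _); elim: g f => [|g IH] f.
  rewrite (sum_tuple0 (fun w => f (pidx 0 w))) expn0 big_ord1.
  by rewrite /pidx big_ord0.
rewrite -addn1 (sum_tuple_cat g 1 (fun w => f (pidx (g + 1) w))).
transitivity (\sum_(u : g.-tuple bool) (f (2 ^ g + pidx g u)%N + f (pidx g u))).
  apply: eq_bigr => u _.
  rewrite (sum_tuple1 (fun v => f (pidx (g + 1) (u ++ v)))) addn1.
  have p b : pidx g.+1 (u ++ [:: b]) = (b * 2 ^ g + pidx g u)%N.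
    rewrite /pidx big_ord_recr /= nth_cat size_tuple ltnn subnn /= addnC; congr addn.
    by apply: eq_bigr => i _; rewrite nth_cat size_tuple ltn_ord.
  by rewrite !p mul1n mul0n add0n.
rewrite big_split /= (IH f) (IH (fun v => f (2 ^ g + v)%N)) addrC.
by rewrite expnD expn1 muln2 -addnn big_split_ord.
Qed.

Lemma avg_prod_sel l0 g (f : nat -> nat -> R) :
  avg (l0 * g) (fun sp => \prod_(j < l0) f j (sel_of g sp j)) =
  \prod_(j < l0) ((2 ^+ g)^-1 * \sum_(v < 2 ^ g) f j v).
Proof.
elim: l0 => [|l0 IH].
  rewrite mul0n big_ord0 (@eq_avg _ _ _ (fun=> 1)) ?avg_const // => w _.
  by rewrite big_ord0.
rewrite mulSnr avg_cat big_ord_recr /= -IH -avg_pidx mulrC -avgZ.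
apply: eq_avg => u su; rewrite mulrC -avgZ; apply: eq_avg => v sv.
rewrite big_ord_recr /= /sel_of drop_size_cat //; congr (_ * _).
apply: eq_bigr => j _; congr f; have jl := ltn_ord j.
rewrite drop_cat su; case: ltnP => h; last first.
  have g0 : g = 0%N by nia.
  by rewrite g0 /pidx !big_ord0.
apply: eq_bigr => i _; rewrite nth_cat size_drop su; have ig := ltn_ord i.
by rewrite (_ : (i < l0 * g - j * g)%N) // -mulnBl; nia.
Qed.

(** Halving the slope is the price of linearity: in the Chernoff bound the sample is only credited
    with half of its fair share. *)
Lemma expRN_le_linear (t : R) : 0 <= t <= 1 -> expR (- t) <= 1 - t / 2.
Proof.
move=> /andP[t0 t1]; rewrite expRN.
apply: (@le_trans _ _ (1 + t)^-1).
  by rewrite lef_pV2 ?expR_ge1Dx // posrE ?expR_gt0 //; lra.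
have h : 0 < 1 + t by lra.
rewrite -[X in X <= _]mul1r ler_pdivrMr //.
have : 0 <= t * (1 - t) by rewrite mulr_ge0 //; lra.
have -> : (1 - t / 2) * (1 + t) = 1 + t * (1 - t) / 2 by field.
lra.
Qed.

(* Exponential moment method: each factor q^(1/M) lies in [1/e, 1]. *)
Lemma avg_heavy_sample l0 g (B : nat) (q : nat -> R) (K kappa : R) :
  (forall i, (2 ^+ B.+1)^-1 <= q i <= 1) ->
  \prod_(i < l0 * 2 ^ g) q i <= expR (- K) ->
  avg (l0 * g) (fun sp =>
    (expR (- kappa) < \prod_(j < l0) q (j * 2 ^ g + sel_of g sp j)%N)%R%:R) <=
  expR (kappa / B.+1%:R - K / (2 * B.+1%:R * 2 ^+ g)).
Proof.
move=> hq hQ; set M : R := B.+1%:R.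
have M0 : 0 < M by rewrite ltr0n.
have q0 i : 0 < q i.
  by have /andP[h _] := hq i; apply: lt_le_trans h; rewrite invr_gt0 pow2_gt0.
(* The information of a cell in nats, scaled to [0,1]; the scale B + 1 works because mixing gives q
   >= 2^-(B+1) and ln 2 <= 1. *)
pose t i := - ln (q i) / M.
have t01 i : 0 <= t i <= 1.
  have /andP[h1 h2] := hq i.
  apply/andP; split.
    by apply: divr_ge0; [rewrite oppr_ge0 ln_le0 | exact: ltW].
  rewrite ler_pdivrMr // mul1r.
  have : ln ((2 ^+ B.+1)^-1) <= ln (q i) by rewrite ler_ln ?posrE ?invr_gt0 ?pow2_gt0.
  rewrite lnV ?posrE ?pow2_gt0 // lnXn // -[_ *+ B.+1]mulr_natr -/M.
  have : ln 2 <= 1 :> R.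
    have -> : 2 = 1 + 1 :> R by [].
    by apply: le_ln1Dx; lra.
  move=> l2 h; have := ler_wpM2r (ltW M0) l2; rewrite mul1r; lra.
have qE i : q i = expR (- (M * t i)).
  by rewrite /t mulrCA divff ?mulr1 ?opprK ?lnK ?posrE // gt_eqF.
have prodE (I : finType) (F : I -> nat) :
    \prod_i q (F i) = expR (- (M * \sum_i t (F i))).
  by rewrite mulr_sumr -sumrN expR_sum; apply: eq_bigr => i _; rewrite qE.
have sumK : K <= M * \sum_(i < l0 * 2 ^ g) t i.
  by move: hQ; rewrite prodE ler_expR lerN2.
(* Markov: on the event, the sampled sum of [t] is below kappa / M, so the exponential bound is at
   least 1. *)
apply: (@le_trans _ _ (avg (l0 * g) (fun sp => expR (kappa / M) *
   \prod_(j < l0) expR (- t (j * 2 ^ g + sel_of g sp j)%N)))).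
  apply: le_avg => sp _.
  case: ltP => [h|_]; last by rewrite mulr_ge0 ?expR_ge0 // prodr_ge0 // => j _;
    exact: expR_ge0.
  rewrite -expR_sum -expRD -[X in X <= _]expR0 ler_expR.
  move: h; rewrite prodE ltr_expR ltrN2 sumrN => h.
  rewrite subr_ge0 ler_pdivlMr // mulrC; exact: ltW.
rewrite avgZ (avg_prod_sel l0 g (fun j v => expR (- t (j * 2 ^ g + v)%N))) expRD.
apply: ler_wpM2l; first exact: expR_ge0.
have G0 : 0 < 2 ^+ g :> R by exact: pow2_gt0.
apply: (@le_trans _ _ (\prod_(j < l0) expR (- ((2 * 2 ^+ g)^-1 *
    \sum_(v < 2 ^ g) t (j * 2 ^ g + v)%N)))).
  apply: ler_prod => j _; apply/andP; split.
    apply: mulr_ge0; first by rewrite invr_ge0 ltW.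
    apply: sumr_ge0 => v _; exact: expR_ge0.
  apply: le_trans (expR_ge1Dx _).
  apply: (@le_trans _ _ ((2 ^+ g)^-1 * \sum_(v < 2 ^ g) (1 - t (j * 2 ^ g + v)%N / 2))).
    apply: ler_wpM2l; first by rewrite invr_ge0 ltW.
    by apply: ler_sum => v _; apply: expRN_le_linear.
  rewrite sumrB -mulr_suml sumr_const card_ord -[_ *+ _]mulr_natr natrX mul1r.
  rewrite le_eqVlt; apply/orP; left; apply/eqP.
  by field; rewrite gt_eqF.
rewrite -expR_sum ler_expR sumrN -mulr_sumr lerN2.
rewrite -(big_mkord xpredT t) in sumK.
have -> : \sum_(j < l0) \sum_(v < 2 ^ g) t (j * 2 ^ g + v)%N = \sum_(i < l0 * 2 ^ g) t i.
  rewrite -(big_mkord xpredT t) big_nat_mul big_mkord; apply: eq_bigr => j _.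
  rewrite -{2}[(j * _)%N]add0n big_addn mulSn addnK big_mkord.
  by apply: eq_bigr => v _; rewrite addnC.
rewrite big_mkord in sumK.
rewrite ler_pdivrMr ?mulr_gt0 //.
apply: le_trans sumK _; rewrite le_eqVlt; apply/orP; left; apply/eqP.
by field; rewrite gt_eqF.
Qed.

End Concentration.

(** * Blocks and rounds *)

Section Block.
Variables (R : realType) (X : finType).

(** The first two terms come from the hash lemma with tau = eta times the mass, the last is twice
    the Chernoff tail. *)
Definition block_slope (m l0 g B : nat) (K kappa eta : R) : R :=
  2 ^+ m * 2 ^+ l0 * expR (- kappa) / eta + eta +
  2 * expR (kappa / B.+1%:R - K / (2 * B.+1%:R * 2 ^+ g)).

(** For a fixed selection the points whose sampled product exceeds e^-kappa are split off and
    charged twice their mass; the hash lemma handles the rest. For a fixed point, a random selection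
    is bad with probability at most the Chernoff tail, unless the full product exceeds e^-K; such
    points have mass at most theta e^K. This last term is not proportional to the mass of P, and
    later conditioning multiplies it. *)
Lemma block_bound (m l0 g B : nat) (T : X -> seq bool) (P : X -> R)
    (theta K kappa eta : R) :
  (forall x, size (T x) = (l0 * 2 ^ g * B)%N) -> injective T -> nonneg P ->
  0 <= theta -> (forall x, P x <= theta) -> 0 < eta ->
  avg (m * (l0 * B)) (fun sh => avg (l0 * g) (fun sp =>
    dev m P (fun x => hash m (l0 * B) sh (samp l0 (2 ^ g) B (sel_of g sp) (T x))))) <=
  block_slope m l0 g B K kappa eta * mass P + 2 * (theta * expR K).
Proof.
move=> sT iT P0 th0 hth eta0.
have mP := mass_ge0 P0.
have th1 : 0 <= theta * expR K by rewrite mulr_ge0 ?expR_ge0.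
have [M0|M0] := eqVneq (mass P) 0.
  rewrite M0 mulr0 add0r.
  rewrite (@eq_avg _ _ _ (fun=> 0)) ?avg_const; first by rewrite mulr_ge0.
  move=> sh _; rewrite (@eq_avg _ _ _ (fun=> 0)) ?avg_const // => sp _.
  exact: dev_mass0.
have {}M0 : 0 < mass P by rewrite lt_neqAle eq_sym M0.
rewrite avgC.
pose q i x := mixw B T P i x.
pose rho := expR (- kappa).
have rho0 : 0 < rho by exact: expR_gt0.
pose hit (sp : seq bool) x := \prod_(j < l0) q (j * 2 ^ g + sel_of g sp j)%N x.
pose good sp x := P x * (hit sp x <= rho)%R%:R.
pose bad sp x := P x * (rho < hit sp x)%R%:R.
have good0 sp : nonneg (good sp) by move=> x; rewrite mulr_ge0.
have bad0 sp : nonneg (bad sp) by move=> x; rewrite mulr_ge0.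
have split_P sp x : P x = good sp x + bad sp x.
  by rewrite /good /bad; case: ltP => _; rewrite ?mulr1 ?mulr0 ?addr0 ?add0r.
pose base := 2 ^+ m * 2 ^+ l0 * rho / eta + eta.
have per_sp sp : avg (m * (l0 * B)) (fun sh => dev m P (fun x =>
    hash m (l0 * B) sh (samp l0 (2 ^ g) B (sel_of g sp) (T x)))) <=
    base * mass P + 2 * mass (bad sp).
  apply: (@le_trans _ _ (avg (m * (l0 * B)) (fun sh => dev m (good sp) (fun x =>
    hash m (l0 * B) sh (samp l0 (2 ^ g) B (sel_of g sp) (T x))) + 2 * mass (bad sp)))).
    apply: le_avg => sh _; rewrite (eq_dev m (split_P sp) (fun x => erefl _)).
    apply: le_trans (dev_add _ _ _ _) _; apply: lerD => //.
    by apply: dev_le_mass => // x; rewrite size_hash.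
  rewrite avgD avg_const; apply: lerD => //.
  (* Scaling tau by the mass makes the hashing error linear in the mass, as summing over
     restrictions requires. *)
  have tau0 : 0 < mass P * eta by rewrite mulr_gt0.
  have good_le : mass (good sp) <= mass P.
    by apply: ler_sum => x _; rewrite [X in _ <= X](split_P sp) lerDl; apply: bad0.
  apply: le_trans (@hash_dev R X m (l0 * B) (good sp) (fun x => samp l0 (2 ^ g) B (sel_of
    g sp) (T x))
    (mass P * 2 ^+ l0 * rho) _ (good0 sp) _ tau0 _) _.
  - by move=> x; rewrite size_samp.
  - move=> v; apply: (@light_sample_mass R X B l0 (2 ^ g) T P sT iT P0) (ltW rho0).
    by move=> j; apply: pidx_lt.
  rewrite /base mulrDl; apply: lerD; last by rewrite mulrC.
  apply: (@le_trans _ _ (2 ^+ m * (mass P * 2 ^+ l0 * rho) * mass P / (mass P * eta))).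
    apply: ler_wpM2r; first by rewrite invr_ge0 ltW.
    apply: ler_wpM2l => //.
    apply: mulr_ge0; first exact: exprn_ge0.
    by apply: mulr_ge0; [apply: mulr_ge0; rewrite ?exprn_ge0 | exact: ltW].
  rewrite le_eqVlt; apply/orP; left; apply/eqP.
  by field; rewrite !gt_eqF.
apply: (@le_trans _ _ (avg (l0 * g) (fun sp => base * mass P + 2 * mass (bad sp)))).
  by apply: le_avg => sp _; apply: per_sp.
rewrite avgD avg_const avgZ /block_slope -/rho -/base.
set conc := expR _.
suff h : avg (l0 * g) (fun sp => mass (bad sp)) <= conc * mass P + theta * expR K.
  apply: le_trans (lerD (lexx (base * mass P)) (ler_wpM2l (ler0n R 2) h)) _.
  by rewrite le_eqVlt; apply/orP; left; apply/eqP; ring.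
rewrite avg_sum.
pose heavy x := (expR (- K) < \prod_(i < l0 * 2 ^ g) q i x)%R.
apply: (@le_trans _ _ (\sum_x (conc * P x + P x * (heavy x)%:R))).
  apply: ler_sum => x _; rewrite avgZ [conc * _]mulrC -mulrDr.
  apply: ler_wpM2l; first exact: P0.
  rewrite /heavy; case: ltP => h.
    apply: (@le_trans _ _ 1); last by rewrite lerDr expR_ge0.
    rewrite -[X in _ <= X](@avg_const R (l0 * g) _); apply: le_avg => sp _.
    by case: (_ < _)%R.
  rewrite addr0; apply: (avg_heavy_sample (q := fun i => q i x)) => // i.
  by apply/andP; split; [exact: mix_ge | exact: mix_le1].
rewrite big_split /= -mulr_sumr; apply: lerD => //.
apply: le_trans (heavy_mass sT iT P0 th0 hth (expR_gt0 _)) _.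
by rewrite expRN invrK.
Qed.

End Block.

Section Iterate.
Variables (R : realType) (X : finType).

(** Used at two levels: for the blocks of a round, where [c] samples and [phi] hashes with the
    shared matrix [sh], and for the sequence of rounds, where [phi] is the identity. *)
Fixpoint blocks (lp : nat) (phi : seq bool -> seq bool -> seq bool)
    (c : seq bool -> X -> seq bool) (t : nat) (sh sps : seq bool) (x : X) : seq bool :=
  if t is t'.+1 then
    phi sh (c (take lp sps) x) ++ blocks lp phi c t' sh (drop lp sps) x
  else [::].

Lemma size_blocks lp phi c t sh sps x m :
  (forall sp x, size (phi sh (c sp x)) = m) ->
  size (blocks lp phi c t sh sps x) = (t * m)%N.
Proof. by move=> h; elim: t sps => //= t IH sps; rewrite size_cat h IH mulSn. Qed.

Lemma blocks_bound (hs lp l m : nat) phi c (theta e1 e2 : R) :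
  (forall sp x, size (c sp x) = l) ->
  (forall sh sp x, size (phi sh (c sp x)) = m) -> 0 <= e2 ->
  (forall P : X -> R, nonneg P -> (forall x, P x <= theta) ->
    avg hs (fun sh => avg lp (fun sp => dev m P (fun x => phi sh (c sp x))))
      <= e1 * mass P + e2) ->
  forall t (P : X -> R), nonneg P -> (forall x, P x <= theta) ->
  avg hs (fun sh => avg (t * lp) (fun sps => dev (t * m) P (blocks lp phi c t sh sps)))
    <= t%:R * (e1 * mass P + 2 ^+ (t * l) * e2).
Proof.
move=> hc hphi e20 H; elim=> [|t IH] P P0 hth.
  rewrite mul0r (@eq_avg _ _ _ (fun=> 0)) ?avg_const // => sh _.
  rewrite (@eq_avg _ _ _ (fun=> 0)) ?avg_const // => sps _.
  rewrite /dev big1 // => z _; rewrite (tuple0 z) /= mul0n expr0 invr1 mul1r.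
  by apply/eqP; rewrite normr_eq0 subr_eq0; apply/eqP/eq_bigr => x _; rewrite mulr1.
rewrite !mulSn.
apply: (@le_trans _ _ (avg hs (fun sh => avg lp (fun u =>
   dev m P (fun x => phi sh (c u x)) +
   \sum_(w : l.-tuple bool) avg (t * lp) (fun v =>
     dev (t * m) (restrict P (c u) w) (blocks lp phi c t sh v)))))).
  apply: le_avg => sh _; rewrite avg_cat; apply: le_avg => u su.
  apply: (@le_trans _ _ (avg (t * lp) (fun v => dev m P (fun x => phi sh (c u x)) +
     \sum_(w : l.-tuple bool)
       dev (t * m) (restrict P (c u) w) (blocks lp phi c t sh v)))).
    apply: le_avg => v _ /=; rewrite take_size_cat // drop_size_cat //.
    exact: dev_cat.
  by rewrite avgD avg_const avg_sum.
rewrite (@eq_avg _ _ _ (fun sh => avg lp (fun u => dev m P (fun x => phi sh (c u x))) +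
   avg lp (fun u => \sum_(w : l.-tuple bool) avg (t * lp) (fun v =>
     dev (t * m) (restrict P (c u) w) (blocks lp phi c t sh v))))); last first.
  by move=> sh _; rewrite avgD.
(* The restriction by the first value of [c] depends on [u] but not on [sh]; averaging over [sh]
   inside lets the induction hypothesis apply to each restricted source. *)
rewrite avgD [X in _ + X <= _]avgC.
apply: (@le_trans _ _ ((e1 * mass P + e2) +
  t%:R * (e1 * mass P + 2 ^+ (l + t * l) * e2))).
  apply: lerD; first exact: H.
  rewrite -[X in _ <= X](@avg_const R lp _); apply: le_avg => u _.
  rewrite avg_sum.
  apply: (@le_trans _ _ (\sum_(w : l.-tuple bool)
    (t%:R * (e1 * mass (restrict P (c u) w) + 2 ^+ (t * l) * e2)))).
    apply: ler_sum => w _; apply: IH; first exact: nonneg_restrict.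
    by move=> x; apply: le_trans (restrict_le _ _ _ P0) (hth x).
  rewrite -mulr_sumr big_split /= -mulr_sumr (mass_restrict P (hc u)).
  by rewrite sum_tuple_const exprD mulrA.
have e2S : e2 <= 2 ^+ (l + t * l) * e2.
  rewrite -[X in X <= _]mul1r; apply: ler_wpM2r => //.
  by rewrite exprn_ege1 // ler1n.
have -> : t.+1%:R = t%:R + 1 :> R by rewrite -addn1 natrD.
rewrite mulrDl mul1r [X in _ <= X]addrC lerD2r; lra.
Qed.

Lemma dev_take m m' (P : X -> R) (f : X -> seq bool) : (m <= m')%N ->
  (forall x, size (f x) = m') -> dev m P (fun x => take m (f x)) <= dev m' P f.
Proof.
move=> mm hf; rewrite -(subnKC mm) in hf *; move: (m' - m)%N hf => e hf.
rewrite /dev (sum_tuple_cat m e (fun z => `|\sum_x P x * (f x == z)%:R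
   - (2 ^+ (m + e))^-1 * mass P|)).
apply: ler_sum => z _.
apply: le_trans (ler_norm_sum _ _ _); rewrite le_eqVlt; apply/orP; left; apply/eqP.
congr `|_|; rewrite sumrB sum_tuple_const exprD invfM; congr (_ - _); last first.
  by field; rewrite !pow2_neq0.
rewrite exchange_big; apply: eq_bigr => x _ /=; rewrite -mulr_sumr; congr (_ * _).
transitivity (\sum_(v : e.-tuple bool) (take m (f x) == z)%:R * (drop m (f x) == v)%:R : R).
  rewrite (sum_tuple_delta (fun=> (take m (f x) == z)%:R)) //.
  by rewrite size_drop hf addKn.
apply: eq_bigr => v _; rewrite -natrM mulnb -eqseq_cat ?cat_take_drop //.
by rewrite size_takel ?size_tuple // hf leq_addr.
Qed.

Lemma avg_take n d (F : seq bool -> R) : (n <= d)%N ->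
  avg d (fun r => F (take n r)) = avg n F.
Proof.
move=> nd; rewrite -(subnKC nd) avg_cat; apply: eq_avg => u su.
by rewrite (@eq_avg _ _ _ (fun=> F u)) ?avg_const // => v _; rewrite take_size_cat.
Qed.

End Iterate.

(** * The extractor as an expression *)

Local Open Scope nat_scope.

(* The least g with n <= 2^g w, for w > 0. *)
Definition dyadic (w n : nat) : nat := \sum_(i < n) (2 ^ i * w < n).

Lemma sum_threshold n g : g <= n -> \sum_(i < n) (i < g) = g.
Proof.
elim: n g => [|n IH] g; first by rewrite leqn0 => /eqP->; rewrite big_ord0.
rewrite leq_eqVlt => /orP[/eqP->|gn]; last by rewrite big_ord_recr /= IH //; lia.
rewrite (eq_bigr (fun=> 1)) ?sum1_card ?card_ord // => i _.
by rewrite ltn_ord.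
Qed.

Lemma dyadicP w n : 0 < w ->
  n <= 2 ^ dyadic w n * w /\ (forall i, i < dyadic w n -> 2 ^ i * w < n).
Proof.
move=> w0.
have ex : exists g, n <= 2 ^ g * w.
  by exists n; have := @ltn_expl 2 n isT; nia.
pose g := ex_minn ex.
have [gP gmin] : n <= 2 ^ g * w /\ forall i, n <= 2 ^ i * w -> g <= i.
  by rewrite /g; case: ex_minnP => g' h1 h2; split.
have gn : g <= n by apply: gmin; have := @ltn_expl 2 n isT; nia.
have E i : (2 ^ i * w < n) = (i < g).
  apply/idP/idP => h; last by rewrite ltnNge; apply/negP => /gmin; lia.
  rewrite ltnNge; apply/negP => gi.
  by have : 2 ^ g <= 2 ^ i by [rewrite leq_pexp2l]; nia.
have -> : dyadic w n = g.
  rewrite -[RHS](sum_threshold gn); apply: eq_bigr => i _; by rewrite E.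
by split => // i; rewrite E.
Qed.

Lemma dyadic_lt w n : 0 < w < n -> 2 ^ dyadic w n * w < 2 * n.
Proof.
case/andP => w0 wn; have [_] := dyadicP n w0.
case: dyadic => [|g] h; first by lia.
by have := h g (leqnn _); rewrite expnS; lia.
Qed.

Lemma dyadic_le w w' n : w' <= w -> dyadic w n <= dyadic w' n.
Proof.
move=> h; apply: leq_sum => i _.
case: (ltnP (2 ^ i * w) n) => // h1.
by have -> : 2 ^ i * w' < n by nia.
Qed.

Section Params.
Variables (A e n : nat).

(* L is about log n, and e is ceil(log2(1/eps)).  A cell has B bits, a sample
   consists of l0 cells, hence of l bits, each cell being chosen among 2^g; a block
   outputs m bits, a round consists of t blocks and uses R seed bits. *)
Definition pL := dyadic 1 n.
Definition pB := pL ^ A.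
Definition pl0 := e * pB.
Definition pl := pl0 * pB.
Definition pg := dyadic pl n.
Definition pm := 4 * pl0 * pL.
Definition pt := 4 * pl.
Definition pR := pm * pl + pt * (pl0 * pg).

Definition seed_index (r : seq bool) (off : nat) : nat :=
  \sum_(u < pg) nth false r (off + u) * 2 ^ u.

(** Seed layout: round q owns the [pR] bits from [q * pR] on, first the matrix row by row, then for
    each block i and each group j the [pg] bits that select a cell. *)
Definition sample_pos (r : seq bool) (o c : nat) : nat :=
  let q := o %/ (pt * pm) in let i := o %% (pt * pm) %/ pm in
  let j := c %/ pB in
  (j * 2 ^ pg + seed_index r (q * pR + pm * pl + i * (pl0 * pg) + j * pg)) * pB
    + c %% pB.

Definition bit_at (r x : seq bool) (o : nat) : nat :=
  let q := o %/ (pt * pm) in let h := o %% (pt * pm) %% pm in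
  \sum_(c < pl) nth false r (q * pR + h * pl + c) * nth false x (sample_pos r o c).

End Params.

(** Truncated subtraction turns this into the indicator of a < b. The quotient below counts the i <
    a with (i + 1) b <= a. *)
Definition Lt a b := Sub (Cst 1) (Sub (Add a (Cst 1)) b).
Definition Div x a b := Sum x (Var a) (Lt (Mul (Add (Var x) (Cst 1)) (Var b)) (Add (Var
  a) (Cst 1))).
Fixpoint Exp x A := if A is A'.+1 then Mul (Var x) (Exp x A') else Cst 1.

(** Variables 2, 4, 6, 7 hold n, B, l, g; 16 and 17 are the seed offsets of the matrix row and of
    the block's selection bits; 20 is the position in the sample, 21 its cell. The cap n on powers
    has no effect once 2^g <= n. *)
Definition body_term : expr :=
  Let 21 (Div 22 20 4)
    (Mul (Bit true (Add (Var 16) (Var 20)))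
      (Bit false (Add (Mul (Add (Mul (Var 21) (Pow (Var 7) (Var 2)))
          (Sum 22 (Var 7) (Mul (Bit true (Add (Add (Var 17) (Mul (Var 21) (Var 7))) (Var
            22)))
                               (Pow (Var 22) (Var 2)))))
        (Var 4)) (Sub (Var 20) (Mul (Var 21) (Var 4)))))).

Definition body_expr : expr := Sum 20 (Var 6) body_term.

(* Variables 0, 1, 2 hold o, e, n. *)
Definition bit_expr (A : nat) : expr :=
  Let 3 (Sum 20 (Var 2) (Lt (Pow (Var 20) (Var 2)) (Var 2)))
  (Let 4 (Exp 3 A)
  (Let 5 (Mul (Var 1) (Var 4))
  (Let 6 (Mul (Var 5) (Var 4))
  (Let 7 (Sum 20 (Var 2) (Lt (Mul (Pow (Var 20) (Var 2)) (Var 6)) (Var 2)))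
  (Let 8 (Mul (Mul (Cst 4) (Var 5)) (Var 3))
  (Let 9 (Mul (Cst 4) (Var 6))
  (Let 10 (Mul (Var 9) (Var 8))
  (Let 11 (Div 20 0 10)
  (Let 12 (Sub (Var 0) (Mul (Var 11) (Var 10)))
  (Let 13 (Div 20 12 8)
  (Let 14 (Sub (Var 12) (Mul (Var 13) (Var 8)))
  (Let 15 (Mul (Var 11) (Add (Mul (Var 8) (Var 6)) (Mul (Var 9) (Mul (Var 5) (Var 7)))))
  (Let 16 (Add (Var 15) (Mul (Var 14) (Var 6)))
  (Let 17 (Add (Add (Var 15) (Mul (Var 8) (Var 6))) (Mul (Var 13) (Mul (Var 5) (Var 7))))
  body_expr)))))))))))))).

Lemma val_let inp x a b env v : expr_val inp a env = v ->
  expr_val inp (Let x a b) env = expr_val inp b (upd env x v).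
Proof. by move=> <-. Qed.
Arguments val_let {inp x a b env} v _.

Lemma val_exp inp x A env : expr_val inp (Exp x A) env = env x ^ A.
Proof. by elim: A => //= A ->; rewrite expnS. Qed.

Lemma val_lt (a b : nat) : 1 - (a + 1 - b) = (a < b).
Proof. by case: ltnP; lia. Qed.

Lemma sum_div (a b : nat) : 0 < b -> \sum_(i < a) (1 - ((i + 1) * b + 1 - (a + 1))) = a
  %/ b.
Proof.
move=> b0.
rewrite -[RHS](sum_threshold (n := a)); last exact: leq_div.
apply: eq_bigr => i _.
by rewrite val_lt !addn1 ltnS leq_divRL.
Qed.

Lemma val_div inp env x a b : a != x -> b != x -> 0 < env b ->
  expr_val inp (Div x a b) env = env a %/ env b.
Proof.
move=> /negbTE ax /negbTE bx b0; rewrite -sum_div //=; apply: eq_bigr => i _.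
by rewrite /upd eqxx ax bx.
Qed.

Lemma val_body inp env : 2 ^ env 7 <= env 2 -> 0 < env 4 ->
  expr_val inp body_expr env =
  \sum_(c < env 6) nth false (inp true) (env 16 + c) * nth false (inp false)
    ((c %/ env 4 * 2 ^ env 7 + \sum_(u < env 7)
        nth false (inp true) (env 17 + c %/ env 4 * env 7 + u) * 2 ^ u) * env 4
      + c %% env 4).
Proof.
move=> g2 b0.
transitivity (\sum_(c < env 6) expr_val inp body_term (upd env 20 (c : nat))); first by [].
apply: eq_bigr => c _.
rewrite /body_term (val_let (c %/ env 4)); last by rewrite val_div.
rewrite /= /upd /=.
rewrite (_ : minn (2 ^ env 7) (env 2) = 2 ^ env 7); last by apply/minn_idPl.
congr (_ * nat_of_bool (nth false _ ((_ + _) * _ + _))).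
  apply: eq_bigr => u _; congr (_ * _); apply/minn_idPl.
  by apply: leq_trans g2; rewrite leq_pexp2l // ltnW.
by rewrite {1}(divn_eq c (env 4)) addKn.
Qed.

Lemma val_bit_expr A r x o e n : 0 < pl A e n -> 0 < pm A e n -> 2 ^ pg A e n <= n ->
  expr_val (fun w : bool => if w then r else x) (bit_expr A) (env3 o e n) =
  bit_at A e n r x o.
Proof.
move=> l0 m0 gn; rewrite /bit_expr.
set inp := fun w : bool => _.
have t0 : 0 < pt A e n * pm A e n by rewrite /pt; nia.
have B0 : 0 < pB A n by move: l0; rewrite /pl; nia.
rewrite (val_let (pL n)); last first.
  rewrite /= /pL /dyadic; apply: eq_bigr => i _; rewrite /upd /= val_lt muln1.
  by congr nat_of_bool; lia.
rewrite (val_let (pB A n)); last by rewrite val_exp.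
rewrite (val_let (pl0 A e n)); last by rewrite /= /upd.
rewrite (val_let (pl A e n)); last by rewrite /= /upd.
rewrite (val_let (pg A e n)); last first.
  rewrite /= /pg /dyadic; apply: eq_bigr => i _; rewrite /upd /= val_lt.
  congr nat_of_bool.
  (* The cap acts only when 2^i >= n, and then both comparisons fail because l >= 1. *)
  have [h|h] := ltnP (2 ^ i) n => //.
  by rewrite !ltnNge leq_pmulr // (leq_trans h) // leq_pmulr.
rewrite (val_let (pm A e n)); last by rewrite /= /upd.
rewrite (val_let (pt A e n)); last by rewrite /= /upd.
rewrite (val_let (pt A e n * pm A e n)); last by rewrite /= /upd.
rewrite (val_let (o %/ (pt A e n * pm A e n))); last by rewrite val_div.
rewrite (val_let (o %% (pt A e n * pm A e n))); last first.
  by rewrite /= /upd /= {1}(divn_eq o (pt A e n * pm A e n)) addKn.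
rewrite (val_let (o %% (pt A e n * pm A e n) %/ pm A e n)); last by rewrite val_div.
rewrite (val_let (o %% (pt A e n * pm A e n) %% pm A e n)); last first.
  by rewrite /= /upd /= {1}(divn_eq (o %% (pt A e n * pm A e n)) (pm A e n)) addKn.
rewrite (val_let (o %/ (pt A e n * pm A e n) * pR A e n)); last by rewrite /= /upd.
set q := o %/ _; set w := o %% _; set i := w %/ _; set h := w %% _.
rewrite (val_let (q * pR A e n + h * pl A e n)); last by rewrite /= /upd.
rewrite (val_let (q * pR A e n + pm A e n * pl A e n + i * (pl0 A e n * pg A e n)));
  last by rewrite /= /upd.
set env := upd _ 17 _.
have e4 : env 4 = pB A n by [].
have e6 : env 6 = pl A e n by [].
have e7 : env 7 = pg A e n by [].
have e2 : env 2 = n by [].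
rewrite val_body ?e4 ?e6 ?e7 ?e2 //.
Qed.

Lemma nth_blocks (X : finType) lp phi (c : seq bool -> X -> seq bool) t sh sps x m o :
  (forall sp x, size (phi sh (c sp x)) = m) -> o < t * m ->
  nth false (blocks lp phi c t sh sps x) o =
  nth false (phi sh (c (take lp (drop (o %/ m * lp) sps)) x)) (o %% m).
Proof.
move=> hs; elim: t sps o => // t IH sps o; rewrite mulSn => om /=.
rewrite nth_cat hs; case: ltnP => h.
  by rewrite divn_small // mul0n drop0 modn_small.
have m0 : 0 < m by lia.
rewrite IH; last by lia.
have dE : o %/ m = ((o - m) %/ m).+1 by rewrite -{1}(subnKC h) divnDl // divnn m0.
have mE : o %% m = (o - m) %% m by rewrite -{1}(subnKC h) modnDl.
by rewrite drop_drop dE mE mulSn addnC.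
Qed.

Arguments nth_blocks {X lp phi c t sh sps x} m {o} _ _.

Lemma nth_hash m l sh y h : h < m ->
  nth false (hash m l sh y) h = ip (take l (drop (h * l) sh)) y.
Proof.
elim: m sh h => // m IH sh [|h] hm /=; first by rewrite mul0n drop0.
by rewrite IH // drop_drop mulSn addnC.
Qed.

Lemma ip_sum u y : ip u y = odd (\sum_(c < size y) nth false u c * nth false y c).
Proof.
elim: y u => [|b y IH] [|a u] //=; rewrite ?big_ord0 //.
  by rewrite big1 // => c _; rewrite nth_nil mul0n.
by rewrite big_ord_recl oddD oddM !oddb /= IH.
Qed.

Lemma samp_nth l0 G B sel y c : c < l0 * B ->
  nth false (samp l0 G B sel y) c =
  nth false y ((c %/ B * G + sel (c %/ B)) * B + c %% B).
Proof. by move=> h; rewrite nth_mkseq. Qed.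

Section Extractor.
Variables (A e n : nat).
Notation L := (pL n).
Notation B := (pB A n).
Notation l0 := (pl0 A e n).
Notation l := (pl A e n).
Notation g := (pg A e n).
Notation m := (pm A e n).
Notation t := (pt A e n).

Definition pad (x : seq bool) : seq bool := mkseq (nth false x) (l0 * 2 ^ g * B).
Definition sample (sp : seq bool) (x : n.-tuple bool) : seq bool :=
  samp l0 (2 ^ g) B (sel_of g sp) (pad x).
Definition round (s : seq bool) (x : n.-tuple bool) : seq bool :=
  blocks (l0 * g) (hash m l) sample t (take (m * l) s) (drop (m * l) s) x.
Definition rounds (s : nat) (r : seq bool) (x : n.-tuple bool) : seq bool :=
  blocks (pR A e n) (fun _ y => y) round s [::] r x.

Lemma size_sample sp x : size (sample sp x) = l.
Proof. exact: size_samp. Qed.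

Lemma size_round s x : size (round s x) = t * m.
Proof. by apply: size_blocks => sp y; rewrite size_hash. Qed.

Lemma size_rounds s r x : size (rounds s r x) = s * (t * m).
Proof. by apply: size_blocks => sp y; rewrite size_round. Qed.

Lemma nth_rounds s r x o : 0 < m -> o < s * (t * m) ->
  nth false (rounds s r x) o = odd (bit_at A e n r x o).
Proof.
move=> m0 os; have t0 : 0 < t * m by lia.
rewrite (nth_blocks (t * m)) //; last by move=> sp y; rewrite size_round.
have ot : o %% (t * m) < t * m by rewrite ltn_mod.
rewrite (nth_blocks m) //; last by move=> sp y; rewrite size_hash.
rewrite nth_hash ?ltn_mod // ip_sum size_sample /bit_at.
set q := o %/ _; set w := o %% _; set i := w %/ m; set h := w %% m.
have hm : h < m by rewrite ltn_mod.
have it : i < t by rewrite ltn_divLR.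
congr odd; apply: eq_bigr => c _.
have cl := ltn_ord c.
congr (nat_of_bool _ * nat_of_bool _).
  rewrite nth_take // nth_drop nth_take; last by nia.
  by rewrite nth_take ?nth_drop ?addnA // /pR; nia.
have B0 : 0 < B by move: cl; rewrite /pl; nia.
have jl : c %/ B < l0 by rewrite ltn_divLR.
rewrite /sample samp_nth // /sel_of /sample_pos -/q -/w -/i.
set p := pidx _ _.
have pE : p = seed_index A e n r (q * pR A e n + m * l + i * (l0 * g) + c %/ B * g).
  rewrite /p /pidx /seed_index; apply: eq_bigr => u _; congr (nat_of_bool _ * _).
  have ug := ltn_ord u.
  rewrite nth_drop nth_take; last by nia.
  rewrite nth_drop nth_drop nth_take; last first.
    rewrite /pR; apply: (@leq_trans (m * l + (i * (l0 * g) + l0 * g))); first by nia.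
    by rewrite leq_add2l -mulSnr leq_mul2r it orbT.
  by rewrite nth_drop; congr nth; lia.
rewrite -pE.
have pg : p < 2 ^ g by apply: pidx_lt.
rewrite nth_mkseq //.
have cB : c %% B < B by rewrite ltn_mod.
have : c %/ B * 2 ^ g + p < l0 * 2 ^ g by nia.
move: (c %/ B * 2 ^ g + p) (l0 * 2 ^ g) (c %% B) cB => a b cc; nia.
Qed.

End Extractor.

(** * Parameters *)

Lemma blocks_take (X : finType) lp phi (c : seq bool -> X -> seq bool) t sh sps x :
  blocks lp phi c t sh (take (t * lp) sps) x = blocks lp phi c t sh sps x.
Proof.
elim: t sps => //= t IH sps; rewrite mulSn take_takel ?leq_addr //.
by rewrite addnC -take_drop IH.
Qed.

Section ParamBounds.
Variables (A e n k mm : nat).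
Notation L := (pL n).
Notation B := (pB A n).
Notation l0 := (pl0 A e n).
Notation l := (pl A e n).
Notation g := (pg A e n).
Notation m := (pm A e n).
Notation t := (pt A e n).

(** Each block aims at error about 2^-E. The slope is at most 4 * 2^-E and there are at most 2^(L+1)
    blocks, so E leaves 2^-e in total with room to spare. *)
Definition pE := e + 2 * L + 6.
(** The part m + l0 + 2E brings 2^m 2^l0 e^-kappa 2^E below 2^-E; the part E (B + 1) brings the
    Chernoff tail e^(-kappa/(B+1)) below e^-E. *)
Definition pkap := m + l0 + 2 * pE + pE * B.+1.
Definition pS := (mm %/ (t * m)).+1.

Hypothesis A0 : 0 < A.
Hypothesis e0 : 0 < e.
Hypothesis n2 : 1 < n.
Hypothesis kn : k <= n.
(** The entropy account: [mm + t * m] for the outputs of all rounds, [t * l] for the samples fixed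
    within one round, L + 2 + e for the number of blocks and the target error, and the last term for
    the heavy points, as e^K <= 2^(2K). *)
Hypothesis budget : mm + t * m + t * l + L + 2 + e + 8 * 2 ^ g * pkap <= k.

Lemma n_le_L : n <= 2 ^ L.
Proof. by have [h _] := @dyadicP 1 n isT; rewrite muln1 in h. Qed.

Lemma L_gt0 : 0 < L.
Proof. by rewrite lt0n; apply/eqP => h; have := n_le_L; rewrite h expn0; lia. Qed.

Lemma B_gt0 : 0 < B.
Proof. by rewrite expn_gt0 L_gt0. Qed.

Lemma l0_gt0 : 0 < l0.
Proof. by rewrite muln_gt0 e0 B_gt0. Qed.

Lemma l_gt0 : 0 < l.
Proof. by rewrite muln_gt0 l0_gt0 B_gt0. Qed.

Lemma m_gt0 : 0 < m.
Proof. by rewrite /pm; have := l0_gt0; have := L_gt0; nia. Qed.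

Lemma t_gt0 : 0 < t.
Proof. by rewrite muln_gt0 l_gt0. Qed.

Lemma g_le_L : g <= L.
Proof. by apply: dyadic_le; apply: l_gt0. Qed.

Lemma n_le_cells : n <= l0 * 2 ^ g * B.
Proof.
have [h _] := dyadicP n l_gt0; apply: leq_trans h _.
by rewrite /pl mulnA [2 ^ _ * _]mulnC.
Qed.

Lemma l_lt_n : l < n.
Proof.
have : t * l <= n by lia.
by rewrite /pt; have := l_gt0; nia.
Qed.

Lemma pow_g_le_n : 2 ^ g <= n.
Proof.
have [_ h] := dyadicP n l_gt0; move: h; rewrite -/(pg A e n).
case: g => [|g'] h; first by rewrite expn0; lia.
have lt := h g' (leqnn _).
have L2 : 2 <= L.
  have := n_le_L; case: (L) => [|[|//]]; rewrite ?expn0 ?expn1 => h2.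
    by lia.
  by have := l_lt_n; have : t * l <= n by [lia]; rewrite /pt; have := l_gt0; nia.
have : 2 <= l.
  have : 2 <= B by apply: leq_trans L2 _; rewrite /pB -{1}(expn1 L) leq_pexp2l // L_gt0.
  by rewrite /pl; have := l0_gt0; nia.
by rewrite expnS; nia.
Qed.

(** A round spends at most half as many seed bits as it outputs: the matrix takes a quarter because
    t = 4 l, the selections at most a quarter because m = 4 l0 L and g <= L. So k seed bits suffice
    for all rounds. *)
Lemma pR_le : 2 * pR A e n <= t * m.
Proof.
have gL := g_le_L; rewrite /pR.
have -> : t * (l0 * g) = 4 * l * (l0 * g) by [].
have h1 : 4 * (m * l) = t * m by rewrite /pt; lia.
have h2 : 4 * (t * (l0 * g)) <= t * m.
  rewrite /pm; apply: (@leq_trans (t * (4 * (l0 * L)))); last by rewrite -!mulnA.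
  by rewrite mulnCA leq_mul2l leq_mul2l leq_mul2l gL !orbT.
by rewrite -/(pt A e n); lia.
Qed.

Lemma rounds_output : mm <= pS * (t * m).
Proof.
rewrite /pS; have h : 0 < t * m by rewrite muln_gt0 t_gt0 m_gt0.
by apply: ltnW; rewrite ltn_ceil.
Qed.

Lemma rounds_output_le : pS * (t * m) <= mm + t * m.
Proof. by rewrite /pS mulSn addnC leq_add2r leq_trunc_div. Qed.

Lemma rounds_seed : pS * pR A e n <= k.
Proof. by have := rounds_output_le; have := pR_le; nia. Qed.

Lemma rounds_blocks : pS * t <= 2 ^ L.+1.
Proof.
have h1 : pS * t <= k.
  have := rounds_output_le; have := m_gt0; have := t_gt0.
  move: budget; move: (8 * _ * pkap) => z; move: pS => s; nia.
have := n_le_L; rewrite expnS; lia.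
Qed.

End ParamBounds.

(** * Numerical bounds and the accumulated error *)

Section Error.
Local Open Scope ring_scope.
Variable R : realType.

Lemma avg0 (F : seq bool -> R) : avg 0 F = F [::].
Proof. by rewrite /avg sum_tuple0 expr0 invr1 mul1r. Qed.

Lemma expR1_ge2 : 2 <= expR 1 :> R.
Proof. by have := expR_ge1Dx (1 : R). Qed.

Lemma expR1_le4 : expR 1 <= 4 :> R.
Proof.
have h : 2^-1 <= expR (- 2^-1) :> R by apply: le_trans (expR_ge1Dx _); lra.
have -> : 1 = 2^-1 * 2%:R :> R by field.
rewrite expRM_natr.
have -> : expR 2^-1 = (expR (- 2^-1))^-1 :> R by rewrite expRN invrK.
rewrite exprVn invf_ple ?posrE ?exprn_gt0 ?expR_gt0 //.
by have := @ler_pM R 2^-1 (expR (-2^-1)) 2^-1 (expR (-2^-1)); rewrite -expr2; lra.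
Qed.

Lemma expR_nat_le a : expR a%:R <= 2 ^+ (2 * a) :> R.
Proof.
rewrite -[a%:R]mulr1 expRM_natl exprM; apply: lerXn2r; rewrite ?nnegrE ?expR_ge0 //.
by apply: le_trans expR1_le4 _; rewrite expr2; lra.
Qed.

Lemma expRN_nat_le a b : (b <= a)%N -> expR (- a%:R) <= (2 ^+ b)^-1 :> R.
Proof.
move=> ba; rewrite expRN lef_pV2 ?posrE ?expR_gt0 ?pow2_gt0 //.
apply: (@le_trans _ _ (expR b%:R)); last by rewrite ler_expR ler_nat.
by rewrite -[b%:R]mulr1 expRM_natl; apply: lerXn2r; rewrite ?nnegrE ?expR_ge0 // expR1_ge2.
Qed.

End Error.

Local Open Scope ring_scope.

Lemma pad_inj A e n : (n <= pl0 A e n * 2 ^ pg A e n * pB A n)%N ->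
  injective (fun x : n.-tuple bool => pad A e n x).
Proof.
move=> h x y /(congr1 (fun s => nth false s)) E.
apply: val_inj; apply: (@eq_from_nth _ false); rewrite !size_tuple // => i ilt.
have := congr1 (fun f => f i) E; rewrite /pad !nth_mkseq //; exact: leq_trans h.
Qed.

Section Final.
Variables (R : realType) (A e n k mm : nat).
Notation L := (pL n).
Notation B := (pB A n).
Notation l0 := (pl0 A e n).
Notation l := (pl A e n).
Notation g := (pg A e n).
Notation m := (pm A e n).
Notation t := (pt A e n).
Hypothesis A0 : (0 < A)%N.
Hypothesis e0 : (0 < e)%N.
Hypothesis n2 : (1 < n)%N.
Hypothesis kn : (k <= n)%N.
Hypothesis budget :
  (mm + t * m + t * l + L + 2 + e + 8 * 2 ^ g * pkap A e n <= k)%N.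

(** A sample takes one cell out of 2^g, so its fair share of K is 4 kappa. The Chernoff bound
    credits 2 kappa of it, and the threshold kappa leaves the exponent -kappa/(B+1). *)
Definition pK : R := (4 * 2 ^ g * pkap A e n)%N%:R.
Definition slope : R :=
  block_slope m l0 g B pK (pkap A e n)%:R (2 ^+ pE e n)^-1.
Definition offset : R := 2 * ((2 ^+ k)^-1 * expR pK).

Lemma offset_ge0 : 0 <= offset.
Proof. by rewrite mulr_ge0 // mulr_ge0 ?expR_ge0 // pow2V_ge0. Qed.

Lemma slope_le : slope <= 4 * (2 ^+ pE e n)^-1.
Proof.
rewrite /slope /block_slope invrK.
set E := pE e n; set kap := pkap A e n.
have E0 : 0 <= (2 ^+ E)^-1 :> R by exact: pow2V_ge0.
have h1 : 2 ^+ m * 2 ^+ l0 * expR (- kap%:R) * 2 ^+ E <= (2 ^+ E)^-1 :> R.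
  apply: (@le_trans _ _ (2 ^+ m * 2 ^+ l0 * (2 ^+ (m + l0 + 2 * E))^-1 * 2 ^+ E)).
    apply: ler_wpM2r; first by rewrite exprn_ge0.
    apply: ler_wpM2l; first by rewrite mulr_ge0 ?exprn_ge0.
    by apply: expRN_nat_le; rewrite /kap /pkap -/E; lia.
  rewrite mul2n -addnn !exprD le_eqVlt; apply/orP; left; apply/eqP.
  by field; rewrite !pow2_neq0.
have h2 : expR (kap%:R / B.+1%:R - pK / (2 * B.+1%:R * 2 ^+ g)) <= (2 ^+ E)^-1 :> R.
  have -> : kap%:R / B.+1%:R - pK / (2 * B.+1%:R * 2 ^+ g) = - (kap%:R / B.+1%:R).
    rewrite /pK !natrM natrX -/kap.
    by field; rewrite pow2_neq0 nat1r pnatr_eq0.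
  apply: (@le_trans _ _ (expR (- E%:R))); last exact: expRN_nat_le.
  rewrite ler_expR lerN2 ler_pdivlMr ?ltr0n // -natrM ler_nat /kap /pkap -/E; lia.
lra.
Qed.

Lemma blocks_err (P : n.-tuple bool -> R) : nonneg P -> (forall x, P x <= (2 ^+ k)^-1) ->
  avg (pR A e n) (fun sp => dev (t * m) P (round A e sp)) <=
  t%:R * slope * mass P + t%:R * (2 ^+ (t * l) * offset).
Proof.
move=> P0 hP; rewrite /pR avg_cat.
rewrite (@eq_avg _ _ _ (fun sh => avg (t * (l0 * g)) (fun sps => dev (t * m) P
   (blocks (l0 * g) (hash m l) (sample A e (n := n)) t sh sps)))); last first.
  move=> u su; apply: eq_avg => v sv; apply: eq_dev => // x.
  by rewrite /round take_size_cat // drop_size_cat.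
rewrite -mulrA -mulrDr.
apply: (blocks_bound (theta := (2 ^+ k)^-1)) => //.
- exact: size_sample.
- by move=> sh sp x; rewrite size_hash.
- exact: offset_ge0.
move=> Q Q0 hQ.
apply: (@block_bound R (n.-tuple bool) m l0 g B (fun x => pad A e n x) Q
  (2 ^+ k)^-1 pK (pkap A e n)%:R (2 ^+ pE e n)^-1 _ _ Q0 (pow2V_ge0 R k) hQ).
- by move=> x; rewrite size_mkseq.
- exact: pad_inj (n_le_cells A0 e0 n2 kn budget).
- by rewrite invr_gt0 pow2_gt0.
Qed.

Lemma rounds_err (P : n.-tuple bool -> R) : nonneg P -> mass P = 1 ->
  (forall x, P x <= (2 ^+ k)^-1) ->
  avg k (fun r => dev mm P (fun x => take mm (rounds A e (pS A e n mm) r x))) <=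
  2 * (2 ^+ e)^-1.
Proof.
move=> P0 P1 hP.
set S := pS A e n mm.
apply: (@le_trans _ _ (avg k (fun r => dev (S * (t * m)) P
    (rounds A e S (take (S * pR A e n) r))))).
  apply: le_avg => r _;
    apply: le_trans (@dev_take R _ mm (S * (t * m)) P (rounds A e S r) _ _) _.
  - exact: (rounds_output A0 e0 n2 kn budget).
  - by move=> x; rewrite size_rounds.
  rewrite le_eqVlt; apply/orP; left; apply/eqP.
  by apply: eq_dev => // x; rewrite /rounds blocks_take.
rewrite (avg_take (fun r => dev (S * (t * m)) P (rounds A e S r)));
  last exact: (rounds_seed A0 e0 n2 kn budget).
(* The outer level: nothing is shared between rounds, so [hs] is 0, and a round conditions on its
   predecessors' output of [t * m] bits. *)
have := @blocks_bound R (n.-tuple bool) 0 (pR A e n) (t * m) (t * m) (fun _ y => y)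
  (@round A e n) (2 ^+ k)^-1 (t%:R * slope) (t%:R * (2 ^+ (t * l) * offset)).
move=> /(_ (@size_round A e n) (fun _ => @size_round A e n)) H.
have := H _ _ S P P0 hP; rewrite avg0 P1 mulr1 => {}H; apply: le_trans (H _ _) _ => {H}.
- by rewrite !mulr_ge0 ?exprn_ge0 // offset_ge0.
- by move=> Q Q0 hQ; rewrite avg0; apply: blocks_err.
have St : S%:R * t%:R <= 2 ^+ L.+1 :> R.
  by rewrite -natrM -natrX ler_nat; apply: (rounds_blocks A0 e0 n2 kn budget).
have eV0 := pow2V_ge0 R e.
have h1 : S%:R * (t%:R * slope) <= (2 ^+ e)^-1.
  apply: (@le_trans _ _ (2 ^+ L.+1 * (4 * (2 ^+ pE e n)^-1))).
    rewrite mulrA; apply: (@le_trans _ _ (S%:R * t%:R * (4 * (2 ^+ pE e n)^-1))).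
      by apply: ler_wpM2l; [rewrite mulr_ge0 | exact: slope_le].
    by apply: ler_wpM2r => //; rewrite mulr_ge0 ?pow2V_ge0.
  have -> : 4 = 2 ^+ 2 :> R by rewrite expr2; ring.
  rewrite mulrA -exprD ler_pdivrMr ?pow2_gt0 // mulrC ler_pdivlMr ?pow2_gt0 //.
  by rewrite -exprD ler_eXn2l ?ltr1n // /pE; lia.
have h2 : S%:R * (2 ^+ (S * (t * m)) * (t%:R * (2 ^+ (t * l) * offset))) <= (2 ^+ e)^-1.
  have -> : S%:R * (2 ^+ (S * (t * m)) * (t%:R * (2 ^+ (t * l) * offset))) =
     S%:R * t%:R * (2 ^+ (S * (t * m)) * 2 ^+ (t * l) * 2 * expR pK * (2 ^+ k)^-1).
    by rewrite /offset; ring.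
  have X0 : 0 <= 2 ^+ (S * (t * m)) * 2 ^+ (t * l) * 2 :> R.
    by rewrite !mulr_ge0 ?exprn_ge0.
  apply: (@le_trans _ _ (2 ^+ L.+1 * (2 ^+ (S * (t * m)) * 2 ^+ (t * l) * 2 *
     2 ^+ (2 * (4 * 2 ^ g * pkap A e n)) * (2 ^+ k)^-1))).
    apply: ler_pM => //.
    apply: ler_wpM2r; first exact: pow2V_ge0.
    by apply: ler_wpM2l => //; apply: expR_nat_le.
  rewrite mulrA ler_pdivrMr ?pow2_gt0 // [X in _ <= X]mulrC ler_pdivlMr ?pow2_gt0 //.
  rewrite -[X in _ * X * _]expr1 -!exprD ler_eXn2l ?ltr1n //.
  have := rounds_output_le A e n mm; rewrite -/S; lia.
rewrite mulrDr; lra.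
Qed.

End Final.

Local Open Scope nat_scope.

(** With b = Q + 1 and h = L / b rounded down, L <= b 2^h while 2^L >= 2^(h Q) 2^h; the spare factor
    2^h absorbs C b^Q. *)
Lemma poly_le_exp (C Q : nat) : exists L0, forall L, L0 <= L -> C * L ^ Q <= 2 ^ L.
Proof.
exists (Q.+1 * (C * Q.+1 ^ Q)) => L hL.
set b := Q.+1 in hL *; set h := L %/ b.
have hC : C * b ^ Q <= h by rewrite /h leq_divRL // mulnC.
have L1 : L <= b * 2 ^ h.
  apply: (@leq_trans (b * h.+1)); first by rewrite mulnC; apply/ltnW; rewrite ltn_ceil.
  by rewrite leq_mul2l ltn_expl ?orbT.
have L2 : h * b <= L by apply: leq_trunc_div.
apply: (@leq_trans (2 ^ (h * b))); last by rewrite leq_pexp2l.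
apply: (@leq_trans (C * (b * 2 ^ h) ^ Q)).
  by rewrite leq_mul2l; case: (Q) => [|q]; rewrite ?expn0 ?orbT // leq_exp2r // L1 orbT.
rewrite expnMn mulnA -expnM.
have -> : h * b = h + h * Q by rewrite /b mulnS.
rewrite expnD leq_mul2r; apply/orP; right.
by apply: leq_trans hC _; apply: ltnW; apply: ltn_expl.
Qed.

(** Every monomial on the left is at most e u L, and 41 is the sum of the coefficients. *)
Lemma cost_bound L e u : 0 < L -> 0 < e -> 0 < u ->
  4 * (e * u) * L + e * u + 2 * (e + 2 * L + 6) + (e + 2 * L + 6) * u.+1
    <= 41 * (e * (u * L)).
Proof.
move=> L1 e1 u1; set w := e * (u * L).
have p1 : 0 < u * L by rewrite muln_gt0 u1.
have p2 : 0 < e * u by rewrite muln_gt0 e1.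
have q1 : L <= w by rewrite /w mulnA leq_pmull.
have q2 : e <= w by rewrite /w leq_pmulr.
have q3 : e * u <= w by rewrite /w mulnA leq_pmulr.
have q4 : L * u <= w by rewrite /w [L * u]mulnC leq_pmull.
have q5 : u <= w by apply: leq_trans q3; rewrite leq_pmull.
have q6 : 0 < w by rewrite muln_gt0 e1.
have E : (e + 2 * L + 6) * u.+1 = e * u + 2 * (L * u) + 6 * u + (e + 2 * L + 6).
  by rewrite -[u.+1]addn1; ring.
have E2 : 4 * (e * u) * L = 4 * w by rewrite /w -!mulnA.
rewrite E E2; move: w q1 q2 q3 q4 q5 q6 {E2 E} => w; lia.
Qed.

Section Budget.
Variables (a e n k mm Gam : nat).
Let A := a + 3.
Notation L := (pL n).
Let P := 4 * A + 1.
Hypothesis kn : k <= n.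
Hypothesis e0 : 0 < e.
Hypothesis n2 : 1 < n.
Hypothesis nk : n <= k * L ^ a.
Hypothesis e4 : e ^ 4 <= 16 * k.
Hypothesis mmk : mm * Gam + k <= Gam * k.
Hypothesis G0 : 0 < Gam.
Hypothesis L_sq : 1312 * Gam <= L ^ 2.
Hypothesis L_exp : 32 * (48 * Gam * L ^ P) ^ 2 * L ^ a <= 2 ^ L.
Hypothesis L_n : 2 ^ L <= 2 * n.

(** The spare entropy k / Gam is shared equally between [D] and [F]. [D] is e^2 polylog(n), about
    sqrt k up to logarithms. For [F], 2^g l < 2n, l is e L^(A+1) times L^(a+2), and n <= k L^a;
    together F L^2 <= 656 k, which is where A = a + 3 and the constant 1312 come from. *)
Lemma budget_holds :
  mm + pt A e n * pm A e n + pt A e n * pl A e n + L + 2 + e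
    + 8 * 2 ^ pg A e n * pkap A e n <= k.
Proof.
have L1 : 0 < L.
  have [h _] := @dyadicP 1 n isT; move: h; rewrite muln1 -/(pL n).
  by case: (pL n) => //; rewrite expn0; lia.
have A1 : 0 < A by rewrite /A; lia.
set D := pt A e n * pm A e n + pt A e n * pl A e n + L + 2 + e.
set F := 8 * 2 ^ pg A e n * pkap A e n.
have La0 : 0 < L ^ a by rewrite expn_gt0 L1.
have LP z : 0 < L ^ z by rewrite expn_gt0 L1.
have HD : 2 * Gam * D <= k.
  have k2 : (48 * Gam * L ^ P) ^ 2 * 16 <= k.
    rewrite -(leq_pmul2r La0); lia.
  have DP : D <= 24 * (e ^ 2 * L ^ P).
    have h1 : pt A e n * pm A e n = 16 * (e ^ 2 * (L ^ (3 * A) * L)).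
      rewrite /pt /pm /pl /pl0 /pB -!mulnn (_ : 3 * A = A + A + A); last by lia.
      by rewrite !expnD; ring.
    have h2 : pt A e n * pl A e n = 4 * (e ^ 2 * L ^ (4 * A)).
      rewrite /pt /pl /pl0 /pB -!mulnn (_ : 4 * A = A + A + A + A); last by lia.
      by rewrite !expnD; ring.
    have p1 : L ^ (3 * A) * L <= L ^ P by rewrite -expnSr leq_pexp2l // /P; lia.
    have p2 : L ^ (4 * A) <= L ^ P by rewrite leq_pexp2l // /P; lia.
    have p3 : L <= L ^ P by rewrite -[X in X <= _]expn1 leq_pexp2l // /P; lia.
    have e2 : e <= e ^ 2 by rewrite -mulnn leq_pmulr.
    rewrite /D h1 h2; move: (LP P) p1 p2 p3 e2;
      move: (L ^ P) (e ^ 2) (L ^ (3 * A) * L) (L ^ (4 * A)) => u v w z u0 p1 p2 p3 e2.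
    have q1 : v * w <= v * u by rewrite leq_mul2l p1 orbT.
    have q2 : v * z <= v * u by rewrite leq_mul2l p2 orbT.
    by nia.
  (* Compared after squaring, because e is controlled through e^4 <= 16 k. *)
  rewrite -leq_sqr; apply: (@leq_trans ((48 * Gam * (e ^ 2 * L ^ P)) ^ 2)).
    by rewrite leq_sqr; nia.
  have -> : (48 * Gam * (e ^ 2 * L ^ P)) ^ 2 = (48 * Gam * L ^ P) ^ 2 * e ^ 4.
    by rewrite -[e ^ 4]/(e ^ (2 * 2)) expnM -!mulnn; ring.
  apply: (@leq_trans ((48 * Gam * L ^ P) ^ 2 * (16 * k)));
    first by rewrite leq_mul2l e4 orbT.
  by rewrite mulnA -mulnn leq_mul2r k2 orbT.
have l0 : 0 < pl A e n by rewrite /pl /pl0 /pB !muln_gt0 e0 !LP.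
have ln : pl A e n < n.
  have : pl A e n < D by rewrite /D /pt; nia.
  by move: HD; nia.
have HF : 2 * Gam * F <= k.
  have cl : 2 ^ pg A e n * pl A e n <= 2 * n by apply/ltnW/dyadic_lt; rewrite l0.
  have kap : pkap A e n <= 41 * (e * (L ^ A * L)).
    by rewrite /pkap /pE /pm /pl0 /pB; apply: cost_bound.
  have plE : pl A e n = e * (L ^ A * L) * (L ^ a * L ^ 2).
    rewrite /pl /pl0 /pB /A -!mulnn !expnD; ring.
  have h : F * (L ^ a * L ^ 2) <= 656 * (k * L ^ a).
    apply: (@leq_trans (8 * 2 ^ pg A e n * (41 * (e * (L ^ A * L))) * (L ^ a * L ^ 2))).
      by rewrite leq_mul2r leq_mul2l kap !orbT.
    apply: (@leq_trans (328 * (2 ^ pg A e n * pl A e n))); last by lia.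
    by rewrite plE; move: (e * _) (L ^ a * _) (2 ^ _) => u v w; nia.
  have h2 : F * L ^ 2 <= 656 * k.
    by rewrite -(leq_pmul2r La0); move: h; move: (L ^ a) (L ^ 2) => u v; nia.
  have h3 : 1312 * Gam * F <= L ^ 2 * F by rewrite leq_mul2r L_sq orbT.
  by move: h2 h3; move: (L ^ 2) => u; nia.
have : Gam * (mm + (D + F)) <= Gam * k by nia.
by rewrite leq_pmul2l // /D /F; lia.
Qed.
End Budget.

(** * The extractor *)

Local Open Scope classical_set_scope.
Local Open Scope ring_scope.

Section Bridge.
Variable R : realType.

(** The seed is part of the output and uniform, so the distance is an average over seeds of
    distances for a fixed seed. *)
Lemma stat_dist_seeded n d m (X : dist R (n.-tuple bool))
    (Ext : n.-tuple bool -> d.-tuple bool -> m.-tuple bool)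
    (E : seq bool -> n.-tuple bool -> seq bool) :
  (forall x r, tval (Ext x r) = E r x) ->
  stat_dist (dmap (fun xu => cat_tuple xu.2 (Ext xu.1 xu.2)) (dprod X (unif R d)))
      (unif R (d + m)) =
  2^-1 * avg d (fun r => dev m X (E r)).
Proof.
move=> hE; congr (_ * _).
pose F (s : seq bool) : R := `|\sum_(xu : n.-tuple bool * d.-tuple bool |
   (xu.2 ++ E xu.2 xu.1 == s)) X xu.1 * (2 ^+ d)^-1 - (2 ^+ (d + m))^-1|.
transitivity (\sum_(z : (d + m).-tuple bool) F z).
  apply: eq_bigr => z _; congr `|_ - _|.
  by apply: eq_bigl => xu; rewrite -val_eqE /= hE.
rewrite sum_tuple_cat /avg mulr_sumr; apply: eq_bigr => u _.
rewrite /dev mulr_sumr; apply: eq_bigr => v _.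
rewrite /F -[X in X * `|_|]ger0_norm ?pow2V_ge0 // -normrM; congr `|_|.
have -> : mass X = 1 by exact: Defs.pmf_sum1.
rewrite mulr1 mulrBr exprD invfM; congr (_ - _).
rewrite big_mkcond -(pair_bigA _ (fun (x : n.-tuple bool) (w : d.-tuple bool) =>
   if w ++ E w x == u ++ v
   then X x * (2 ^+ d)^-1 else 0)) mulr_sumr /=.
apply: eq_bigr => x _.
transitivity (\sum_(w : d.-tuple bool) (X x * (2 ^+ d)^-1 * (E w x == v)%:R) * ((u : seq
  bool) == w)%:R).
  apply: eq_bigr => w _; rewrite eqseq_cat ?size_tuple // [_ == (w : seq bool)]eq_sym.
  by case: eqP => _; case: eqP => _; rewrite /= ?mulr1 ?mulr0.
rewrite (sum_tuple_delta (fun w => X x * (2 ^+ d)^-1 * (E w x == v)%:R)) ?size_tuple //.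
ring.
Qed.

Lemma ln2_gt0 : 0 < ln 2 :> R.
Proof. by rewrite ln_gt0 // ltr1n. Qed.

Lemma log2_pow2 e : log2 (2 ^+ e) = e%:R :> R.
Proof. by rewrite /log2 lnXn // -[_ *+ e]mulr_natl mulfK // gt_eqF ?ln2_gt0. Qed.

Lemma ler_log2 (x y : R) : 0 < x -> 0 < y -> (log2 x <= log2 y) = (x <= y).
Proof. by move=> x0 y0; rewrite ler_pM2r ?invr_gt0 ?ln2_gt0 // ler_ln. Qed.

Lemma log2V (x : R) : 0 < x -> log2 x^-1 = - log2 x.
Proof. by move=> x0; rewrite /log2 lnV ?posrE // mulNr. Qed.

Lemma min_entropy_le (T : finType) (X : dist R T) k :
  k%:R <= min_entropy X -> forall x, X x <= (2 ^+ k)^-1.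
Proof.
move=> h x; set M := \big[Num.max/0]_x X x.
have hM y : X y <= M by exact: (le_bigmax (0 : R) X y).
(* Masses sum to 1, so the maximum is not the default 0 and its logarithm is meaningful. *)
have M0 : 0 < M.
  rewrite lt_neqAle; apply/andP; split; last exact: le_trans (Defs.pmf_ge0 X x) (hM x).
  apply/eqP => E; have := Defs.pmf_sum1 X; rewrite big1 => [/eqP|y _].
    by rewrite eq_sym oner_eq0.
  by apply/eqP; rewrite eq_le Defs.pmf_ge0 E hM.
apply: le_trans (hM x) _.
rewrite -ler_log2 ?invr_gt0 ?pow2_gt0 // log2V ?pow2_gt0 // log2_pow2.
by move: h; rewrite /min_entropy -/M; lra.
Qed.

End Bridge.

Section Ext.
Variables (R : realType) (A : nat).

Definition ell (eps : R) : nat := `|Num.ceil (log2 eps^-1)|%N.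

Definition ext_word (e n m : nat) (r x : seq bool) : seq bool :=
  mkseq (fun o => odd (expr_val (fun w : bool => if w then r else x)
    (bit_expr A) (env3 o e n))) m.

Lemma size_ext_word e n m r x : size (ext_word e n m r x) == m.
Proof. by rewrite size_mkseq. Qed.

Definition ext (d m : nat -> nat) (n : nat) (eps : R) (x : n.-tuple bool)
  (r : (d n).-tuple bool) : (m n).-tuple bool :=
  Tuple (size_ext_word (ell eps) n (m n) r x).

Arguments ext : clear implicits.

(** No regime of parameters is assumed: the word is defined as the value of the expression
    everywhere, and only its extraction property needs the budget. *)
Lemma explicit_ext (k d m : nat -> nat) : explicit k (ext d m).
Proof.
have [M [c H]] := tm_emits (bit_expr A).
exists M, c => n eps x r _ /=.
have := H (k n) (m n) (ell eps) (tval x) (tval r).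
by rewrite size_tuple.
Qed.

Section Regime.
Variables (e n k m : nat).
Hypothesis A0 : (0 < A)%N.
Hypothesis e0 : (0 < e)%N.
Hypothesis n2 : (1 < n)%N.
Hypothesis kn : (k <= n)%N.
Hypothesis budget : (m + pt A e n * pm A e n + pt A e n * pl A e n + pL n + 2 + e
    + 8 * 2 ^ pg A e n * pkap A e n <= k)%N.

Lemma ext_wordE r x : ext_word e n m r x =
  mkseq (fun o => odd (bit_at A e n r x o)) m.
Proof.
apply: eq_mkseq => o; congr odd; apply: val_bit_expr.
- exact: l_gt0 budget.
- exact: m_gt0 budget.
- exact: pow_g_le_n budget.
Qed.

Lemma ext_word_rounds r (x : n.-tuple bool) :
  ext_word e n m r x = take m (rounds A e (pS A e n m) r x).
Proof.
rewrite ext_wordE; have h := rounds_output A0 e0 n2 kn budget.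
apply: (@eq_from_nth _ false).
  by rewrite size_mkseq size_takel // size_rounds.
rewrite size_mkseq => o om; rewrite nth_mkseq // nth_take // nth_rounds //.
  exact: m_gt0 budget.
exact: leq_trans h.
Qed.

Lemma ext_word_local r (o : 'I_m) : exists S : {set 'I_n},
  (#|S| <= pl A e n)%N /\ forall x y : n.-tuple bool,
   (forall i, i \in S -> tnth x i = tnth y i) ->
   nth false (ext_word e n m r x) o = nth false (ext_word e n m r y) o.
Proof.
pose s := [seq sample_pos A e n r o c | c <- iota 0 (pl A e n)].
exists [set i : 'I_n | (i : nat) \in s]%SET; split.
  rewrite cardE -(size_map val); have <- : size s = pl A e n by rewrite size_map size_iota.
  apply: uniq_leq_size; first by rewrite map_inj_uniq ?enum_uniq //; exact: val_inj.
  by move=> j /mapP[i]; rewrite mem_enum inE => h ->.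
move=> x y xy; rewrite !ext_wordE !nth_mkseq //; congr odd.
apply: eq_bigr => c _; congr (_ * nat_of_bool _)%N.
set p := sample_pos _ _ _ _ _ _.
(* Positions at or beyond n fall into the padding and read [false] for both inputs. *)
case: (ltnP p n) => [pn|np]; last by rewrite !nth_default ?size_tuple.
have := xy (Ordinal pn); rewrite !(tnth_nth false); apply.
by rewrite inE; apply/mapP; exists (c : nat) => //; rewrite mem_iota /= add0n ltn_ord.
Qed.

End Regime.
End Ext.

(** * Large n and the choice of constants *)

Section Asymptotics.
Variable R : realType.

Lemma ell_bounds (eps : R) : 0 < eps < 1 ->
  [/\ log2 eps^-1 <= (ell eps)%:R, (ell eps)%:R < log2 eps^-1 + 1 & (0 < ell eps)%N].
Proof.
move=> /andP[p0 p1].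
have l0 : 0 < log2 eps^-1.
  by rewrite divr_gt0 ?ln2_gt0 // ln_gt0 // invf_gt1.
have c0 : 0 <= Num.ceil (log2 eps^-1) by rewrite ceil_ge0; lra.
have E : (ell eps)%:R = (Num.ceil (log2 eps^-1))%:~R :> R.
  by rewrite /ell -[in RHS](gez0_abs c0).
have h1 : log2 eps^-1 <= (ell eps)%:R by rewrite E ceil_ge.
split => //.
  by have := ceilB1_lt (log2 eps^-1); rewrite intrB -E; lra.
by rewrite -(ltr_nat R); lra.
Qed.

Lemma pow2_ell (eps : R) : 0 < eps < 1 -> (2 ^+ ell eps)^-1 <= eps.
Proof.
move=> h; have [h1 _ _] := ell_bounds h; have /andP[p0 _] := h.
rewrite -ler_log2 ?invr_gt0 ?pow2_gt0 // log2V ?pow2_gt0 // log2_pow2.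
by rewrite log2V // in h1; lra.
Qed.

Lemma pL_bounds n : (1 < n)%N ->
  [/\ log2 n%:R <= (pL n)%:R :> R, (pL n)%:R <= 2 * log2 n%:R :> R,
      (2 ^ pL n <= 2 * n)%N & (n <= 2 ^ pL n)%N].
Proof.
move=> n2; have [h1 _] := @dyadicP 1 n isT.
have h2 := @dyadic_lt 1 n n2.
rewrite muln1 -/(pL n) in h1; rewrite muln1 -/(pL n) in h2.
have n0 : 0 < n%:R :> R by rewrite ltr0n; lia.
have l2 : 1 <= log2 n%:R :> R.
  have e1 : log2 2 = 1 :> R by exact: (log2_pow2 R 1).
  by rewrite -[X in X <= _]e1 ler_log2 // ler_nat.
have hl : (pL n)%:R <= log2 n%:R + 1 :> R.
  have -> : log2 n%:R + 1 = log2 (n%:R * 2) :> R.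
    by rewrite /log2 lnM ?posrE // mulrDl divff // gt_eqF ?ln2_gt0.
  rewrite -log2_pow2 ler_log2 ?pow2_gt0 ?mulr_gt0 //.
  by rewrite -natrX -natrM ler_nat mulnC ltnW.
split => //; [|lra|exact: ltnW].
by rewrite -[X in _ <= X]log2_pow2 ler_log2 ?pow2_gt0 // -natrX ler_nat.
Qed.

Lemma fourth_root_bound (y : R) (e k : nat) : 1 <= y -> y ^+ 4 = k%:R ->
  e%:R <= y + 1 -> (e ^ 4 <= 16 * k)%N.
Proof.
move=> y1 yk ey; rewrite -(ler_nat R) natrX natrM -yk.
have -> : 16%:R * y ^+ 4 = (2 * y) ^+ 4 by rewrite exprMn; congr (_ * _); ring.
by apply: lerXn2r; rewrite ?nnegrE //; lra.
Qed.

End Asymptotics.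

Theorem mainTheorem12 (R : realType) (delta : nat -> R) (k : nat -> nat)
    (a : nat) (gamma : R) :
  (\forall n \near \oo,
     (k n)%:R = delta n * n%:R /\ (log2 n%:R ^+ a)^-1 <= delta n <= 1) ->
  0 < gamma < 1 ->
  exists (alpha beta : R) (c : nat),
    0 < alpha <= 1 /\ 0 < beta < 1 /\
    let d n := `|Num.ceil ((k n)%:R `^ alpha)|%N in
    let m n := Num.truncn ((1 - gamma) * (k n)%:R) in
    exists Ext : forall n, R ->
        n.-tuple bool -> (d n).-tuple bool -> (m n).-tuple bool,
      explicit k Ext /\
      forall eps0 : R, eps0 < 1 ->
      \forall n \near \oo, forall eps : R,
        2 `^ (- ((k n)%:R `^ beta)) <= eps <= eps0 ->
        strong_extractor (k n)%:R eps (Ext n eps) /\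
        locality_le (log2 eps^-1 ^+ 2 * log2 n%:R ^+ c) (Ext n eps).
Proof.
move=> [N0 _ Hk] /andP[g0 g1].
pose A := (a + 3)%N.
(* With beta = 1/4 a round handles about sqrt k bits up to logarithms. The locality is e L^(2A); one
   more factor log n absorbs the constants. *)
exists 1, 4^-1, (2 * A + 1)%N; do 2 (split; first by lra).
move=> d m; exists (@ext R A d m); split; first exact: explicit_ext.
have dE n : d n = k n.
  by rewrite /d powRr1 // -[(k n)%:R]/((k n)%:Z%:~R) intrKceil.
move=> eps0 eps01.
(* If eps0 <= 0 no eps qualifies, since its lower bound is positive. *)
have [eps00|eps0p] := lerP eps0 0.
  near=> n => eps /andP[h1 h2].
  have := powR_gt0 (- ((k n)%:R `^ 4^-1)) (ltr0n R 2); lra.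
pose lam0 := log2 eps0^-1.
have lam00 : 0 < lam0 by rewrite divr_gt0 ?ln2_gt0 // ln_gt0 // invf_gt1.
(* For lam >= lam0 > 0, e <= lam + 1 <= lam^2 (1/lam0 + 1/lam0^2), and L <= 2 log2 n gives the power
   of 2. Keeping eps below eps0 < 1 is what makes lam0 positive. *)
pose C0 := (lam0^-1 + (lam0 ^+ 2)^-1) * 2 ^+ (2 * A).
pose Gam := (Num.truncn gamma^-1).+1.
have Gam0 : (0 < Gam)%N by [].
have gG : 1 <= gamma * Gam%:R.
  rewrite mulrC -ler_pdivrMr // mul1r; apply/ltW.
  by have /andP[] := truncn_itv (ltW (eqbRL (invr_gt0 gamma) g0)).
pose P := (4 * A + 1)%N.
have [L1 HL1] := poly_le_exp (32 * (48 * Gam) ^ 2) (2 * P + a).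
have [L0 [L0a L0b L0c L0d]] : exists L0, [/\ L1 <= L0, 1312 * Gam <= L0,
    2 * (Num.truncn C0).+1 <= L0 & 2 <= L0]%N.
  exists (L1 + 1312 * Gam + 2 * (Num.truncn C0).+1 + 2)%N.
  by move: (1312 * Gam)%N (2 * _.+1)%N => u v; split; clear; lia.
exists (N0 + 2 ^ L0 + 2)%N => // n /= nN eps /andP[epsl epsu].
have [n2 nN0 nL0] : [/\ 1 < n, N0 <= n & 2 ^ L0 <= n]%N.
  by move: nN; move: (2 ^ L0)%N => u; clear; split; lia.
have [//|kE /andP[dl d1]] := Hk n.
have [Lb1 Lb2 Lb3 Lb4] := pL_bounds R n2.
set L := pL n in Lb1 Lb2 Lb3 Lb4.
have LL0 : (L0 <= L)%N.
  by rewrite -(@leq_exp2l 2) //; apply: leq_trans Lb4.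
have n0 : 0 < n%:R :> R by rewrite ltr0n ltnW.
have lg0 : 0 < log2 n%:R :> R.
  have : 0 < L%:R :> R by rewrite ltr0n (leq_trans _ LL0) // ltnW.
  lra.
have kn : (k n <= n)%N.
  by rewrite -(ler_nat R) kE -[X in _ <= X]mul1r ler_pM2r.
have nk : (n <= k n * L ^ a)%N.
  rewrite -(ler_nat R) natrM natrX kE.
  have la0 : 0 < log2 n%:R ^+ a :> R by rewrite exprn_gt0.
  apply: (@le_trans _ _ (delta n * n%:R * log2 n%:R ^+ a)).
    rewrite mulrAC -[X in X <= _]mul1r ler_pM2r //.
    by rewrite -ler_pdivrMr // mul1r.
  apply: ler_wpM2l; first by rewrite -kE.
  by apply: lerXn2r; rewrite ?nnegrE //; lra.
have k1 : (0 < k n)%N by move: nk n2; case: (k n) => //; rewrite mul0n leqn0 => /eqP->.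
have epos : 0 < eps < 1.
  apply/andP; split; last lra.
  by apply: lt_le_trans epsl; apply: powR_gt0.
have [eb1 eb2 e0] := ell_bounds epos.
have /andP[ep0 ep1] := epos.
set e := ell eps in eb1 eb2 e0.
set lam := log2 eps^-1 in eb1 eb2.
have lam_ge : lam0 <= lam.
  by rewrite /lam0 /lam ler_log2 ?invr_gt0 // lef_pV2 ?posrE.
have e4 : (e ^ 4 <= 16 * k n)%N.
  apply: (@fourth_root_bound R ((k n)%:R `^ 4^-1)).
  - by rewrite -[X in X <= _](powRr0 (k n)%:R) ler_powR ?ler1n //; lra.
  - by rewrite -powR_mulrn ?powR_ge0 // -powRrM mulVf // powRr1.
  - apply: (@le_trans _ _ (lam + 1)); first exact: ltW.
    rewrite lerD2r /lam log2V // /log2.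
    have : ln (2 `^ (- (k n)%:R `^ 4^-1)) <= ln eps by rewrite ler_ln ?posrE ?powR_gt0.
    rewrite ln_powR => h.
    by rewrite -mulNr ler_pdivrMr ?ln2_gt0 //; lra.
have mk : (m n)%:R <= (1 - gamma) * (k n)%:R.
  by rewrite /m truncn_le mulr_ge0 //; lra.
have mmk : (m n * Gam + k n <= Gam * k n)%N.
  rewrite -(ler_nat R) natrD !natrM.
  have G1 : 0 <= Gam%:R :> R by [].
  have h1 := ler_wpM2r G1 mk.
  have h2 := ler_wpM2r (ler0n R (k n)) gG.
  lra.
have bud := @budget_holds a e n (k n) (m n) Gam kn e0 n2 nk e4 mmk Gam0.
have {}bud := bud _ _ Lb3.
have budget : (m n + pt A e n * pm A e n + pt A e n * pl A e n + L + 2 + e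
    + 8 * 2 ^ pg A e n * pkap A e n <= k n)%N.
  apply: bud.
    rewrite -/L; apply: (leq_trans L0b); apply: (leq_trans LL0).
    by rewrite -[X in (X <= _)%N]expn1 leq_pexp2l // (leq_trans _ LL0) // ltnW.
  rewrite -/L -/A -/P expnMn mulnA -[X in (X <= _)%N]mulnA -expnM -expnD [(P * 2)%N]mulnC.
  by apply: HL1; apply: leq_trans LL0.
have A0 : (0 < A)%N by rewrite /A addn3.
split.
  move=> X hX; have hP := min_entropy_le hX.
  rewrite (@stat_dist_seeded R n (d n) (m n) X _ (fun r x => ext_word A e n (m n) r x)) //.
  rewrite dE.
  have H := @rounds_err R A e n (k n) (m n) A0 e0 n2 kn budget X (@Defs.pmf_ge0 _ _ X)
    (Defs.pmf_sum1 X) hP.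
  rewrite (@eq_avg R _ _ (fun r => dev (m n) X
    (fun x => take (m n) (rounds A e (pS A e n (m n)) r x)))); last first.
    move=> r _; apply: eq_dev => // x.
    by rewrite (ext_word_rounds A0 e0 n2 kn budget).
  have h2 : 0 <= 2^-1 :> R by rewrite invr_ge0.
  (* The factor 1/2 of the statistical distance cancels the 2 in front of 2^-e. *)
  apply: le_trans (ler_wpM2l h2 H) _; rewrite mulrA mulVf ?mul1r ?pnatr_eq0 //.
  exact: pow2_ell epos.
move=> r j.
have [S [S1 S2]] := ext_word_local A0 e0 n2 kn budget r j.
exists S; split; last by move=> x y xy; rewrite !(tnth_nth false); apply: S2.
apply: (@le_trans _ _ (pl A e n)%:R); first by rewrite ler_nat.
have lgB : C0 <= log2 n%:R.
  have C00 : 0 <= C0.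
    rewrite /C0; apply: mulr_ge0; last exact: exprn_ge0.
    by apply: addr_ge0; rewrite invr_ge0 ?exprn_ge0 // ltW.
  have /andP[_ hC] := truncn_itv C00.
  have h2 : (2 * (Num.truncn C0).+1)%:R <= L%:R :> R.
    by rewrite ler_nat (leq_trans L0c).
  rewrite natrM in h2.
  have : 2 * (Num.truncn C0).+1%:R <= 2 * log2 n%:R :> R by exact: le_trans h2 Lb2.
  by rewrite ler_pM2l // => h3; apply: ltW; apply: lt_le_trans h3.
have -> : pl A e n = (e * L ^ (2 * A))%N.
  by rewrite /pl /pl0 /pB -/L -(mulnA e) -expnD addnn mul2n.
rewrite natrM natrX.
have lam_pos : 0 < lam by apply: lt_le_trans lam_ge.
have e_le : e%:R <= lam ^+ 2 * (lam0^-1 + (lam0 ^+ 2)^-1).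
  apply: (@le_trans _ _ (lam + 1)); first exact: ltW.
  rewrite mulrDr; apply: lerD.
    by rewrite expr2 -mulrA -[X in X <= _]mulr1 ler_pM2l // ler_pdivlMr // mul1r.
  rewrite ler_pdivlMr ?exprn_gt0 // mul1r.
  by apply: lerXn2r; rewrite ?nnegrE //; apply: ltW.
apply: (@le_trans _ _ (lam ^+ 2 * (lam0^-1 + (lam0 ^+ 2)^-1) * (2 * log2 n%:R) ^+ (2 * A))).
  apply: ler_pM; [by [] | by rewrite exprn_ge0 | exact: e_le |].
  apply: lerXn2r; rewrite ?nnegrE //.
  by apply: mulr_ge0 => //; apply: ltW.
rewrite [(2 * _) ^+ _]exprMn [log2 _ ^+ (_ + 1)]exprD expr1.
set Y := log2 n%:R ^+ (2 * A).
have -> : lam ^+ 2 * (lam0^-1 + (lam0 ^+ 2)^-1) * (2 ^+ (2 * A) * Y) =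
    lam ^+ 2 * Y * C0 by rewrite /C0; ring.
rewrite [X in _ <= X]mulrA; apply: ler_wpM2l => //.
by apply: mulr_ge0; apply: exprn_ge0; apply: ltW.
Unshelve. all: by end_near.
Qed.
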